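(* Assume $\alpha\in\mathbb{J}$ and $P=\{P_1,\ldots,P_n\}\in\mathscr{P}_{\beta_1,\ldots,\beta_n,R}$ for some $\beta_1,\ldots,\beta_n\in\mathbb{J}$ and $R>0$, and let $$\gamma\in\mathcal{E}_\alpha:=\{\gamma\in\mathbb{J}:\ \mathtt{r}(\gamma)\in(\mathtt{r}(\alpha)-1,\mathtt{r}(\alpha)]\ \text{ and }\ \gamma\stackrel{S(t)}{\leadsto}\alpha\}.$$ Then for $u_0\in X^\gamma$ there is a unique $u=u(\cdot,u_0)$ in $\mathcal{L}^\infty_{\alpha,d(\alpha,\gamma)}$ satisfying $$u(t)=S(t)u_0+\sum_{i=1}^n\int_0^tS(t-\tau)P_iu(\tau)\,d\tau$$ for each $t>0$. Therefore we have a family of linear operators $\{S_P(t)\}_{t\ge0}$ in $X^\gamma$ given by $S_P(0)u_0=u_0$ and $S_P(t)u_0=u(t,u_0)$ for $t>0$, and $\{S_P(t)\}_{t\ge0}$ continuously smooths from $X^\gamma$ to $X^\alpha$ for positive times, that is, $\gamma\stackrel{S_P(t)}{\leadsto}\alpha$. Finally, $\beta_i\in\mathcal{E}_\alpha$ and in particular $\beta_i\stackrel{S_P(t)}{\leadsto}\alpha$ for $i=1,\ldots,n$. Also, if $\alpha\stackrel{S(t)}{\leadsto}\alpha$ then $\alpha\in\mathcal{E}_\alpha$ and $\alpha\stackrel{S_P(t)}{\leadsto}\alpha$.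
   Context: Scale of spaces: $\mathbb{J}$ is a set of indices and $\{X^\gamma\}_{\gamma\in\mathbb{J}}$ a family of Banach spaces (norms $\|\cdot\|_\gamma$) that is topologically consistent: if a sequence in $X^\gamma\cap X^{\tilde\gamma}$ converges in both spaces, the limits coincide. A map $\mathtt{r}:\mathbb{J}\to\mathbb{R}$ (regularity index) is given and $d(\tilde\gamma,\gamma):=\mathtt{r}(\tilde\gamma)-\mathtt{r}(\gamma)$. $\{S(t)\}_{t\ge0}$ is a family of linear operators with $S(0)=I$ defined consistently on the spaces of the scale (if $u_0\in X^\gamma\cap X^{\tilde\gamma}$, the values of $S(t)u_0$ in the two spaces coincide). Smoothing: $\gamma\stackrel{S(t)}{\dashrightarrow}\tilde\gamma$ means that $d(\tilde\gamma,\gamma)\ge0$ and for any $T>0$ there is a constant $M=M(\gamma,\tilde\gamma,T)$ (nondecreasing in $T$) with $\|S(t)\|_{\mathcal{L}(X^\gamma,X^{\tilde\gamma})}\le M t^{-d(\tilde\gamma,\gamma)}$ for $0<t\le T$. $\gamma\stackrel{S(t)}{\leadsto}\tilde\gamma$ means that in addition $(0,\infty)\ni t\mapsto S(t)u_0\in X^{\tilde\gamma}$ is continuous for each $u_0\in X^\gamma$. The same notations are used for the family $S_P$. Perturbations: for fixed $\alpha\in\mathbb{J}$, $R>0$ and $\beta\in\mathbb{J}$, $\mathscr{P}_{\beta,R}$ is the set of $P\in\mathcal{L}(X^\alpha,X^\beta)$ with $\|P\|_{\mathcal{L}(X^\alpha,X^\beta)}\le R$, where $\alpha,\beta$ satisfy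 $0\le d(\alpha,\beta)<1$ and $\beta\stackrel{S(t)}{\leadsto}\alpha$. $P=\{P_1,\ldots,P_n\}\in\mathscr{P}_{\beta_1,\ldots,\beta_n,R}$ means $P_i\in\mathscr{P}_{\beta_i,R}$ for each $i$. Function spaces: for $T>0$, $\varepsilon\ge0$, $\mathcal{L}^\infty_{\alpha,\varepsilon}((0,T])$ is the set of (strongly measurable) $\varphi\in L^\infty_{loc}((0,T],X^\alpha)$ with $\sup_{t\in(0,T]}t^\varepsilon\|\varphi(t)\|_\alpha<\infty$, and $\mathcal{L}^\infty_{\alpha,\varepsilon}=\bigcap_{T>0}\mathcal{L}^\infty_{\alpha,\varepsilon}((0,T])$. *)

(* Defs.v *)
From HB Require Import structures.
From mathcomp Require Import all_boot all_order all_algebra.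
From mathcomp Require Import all_classical all_reals all_analysis.

Set Implicit Arguments.
Unset Strict Implicit.
Unset Printing Implicit Defensive.

Import Order.TTheory GRing.Theory Num.Theory.
Import numFieldNormedType.Exports.

Local Open Scope classical_set_scope.
Local Open Scope ring_scope.

(* The vector space [ambient] only serves to give a meaning to the
   intersections of the spaces: an element of X^g \cap X^g' is a pair (x, y)
   with [emb g x = emb g' y]. *)
Record banach_scale (R : realType) (J : Type) := BanachScale {
  ambient : lmodType R ;
  banach_at : J -> completeNormedModType R ;
  emb : forall g : J, {linear banach_at g -> ambient} ;
  emb_inj : forall g : J, injective (emb g) ;
  scale_consistent : forall (g g' : J) (u : nat -> banach_at g)
      (v : nat -> banach_at g') (x : banach_at g) (y : banach_at g'),
    (forall n, emb g (u n) = emb g' (v n)) ->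
    u @ \oo --> x -> v @ \oo --> y -> emb g x = emb g' y ;
  regularity : J -> R
}.

Section Bochner.
Context {R : realType} {V : completeNormedModType R}.

Definition simple_function (s : R -> V) : Prop :=
  finite_set (range s) /\
  forall v : V, measurable (s @^-1` [set v] : set (measurableTypeR R)).

Definition strongly_measurable (D : set R) (f : R -> V) : Prop :=
  exists2 s : nat -> R -> V, (forall n, simple_function (s n)) &
    {ae (@lebesgue_measure R), forall t, D t -> s n t @[n --> \oo] --> f t}.

(* The sum has finitely many nonzero terms when [s] is simple, and the measures
   are finite, so that [fine] loses nothing. *)
Definition simple_integral (a b : R) (s : R -> V) : V :=
  \sum_(v \in [set: V])
    fine ((@lebesgue_measure R) (`]a, b[ `&` s @^-1` [set v])) *: v.

(* [f] is Bochner integrable on (a, b) and its integral is [I]. Only the values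
   of [f] on the open interval matter. *)
Definition is_bochner_integral (a b : R) (f : R -> V) (I : V) : Prop :=
  strongly_measurable `]a, b[ f /\
  exists s : nat -> R -> V,
    [/\ forall n, simple_function (s n),
        (\int[@lebesgue_measure R]_(t in `]a, b[) (`|f t - s n t|)%:E)%E
          @[n --> \oo] --> 0%E
      & simple_integral a b (s n) @[n --> \oo] --> I].

Definition Linfty_loc (T : R) (phi : R -> V) : Prop :=
  strongly_measurable `]0, T] phi /\
  forall K : set R, compact K -> K `<=` `]0, T] ->
    exists C : R, {ae (@lebesgue_measure R), forall t, K t -> `|phi t| <= C}.

Definition weighted_Linfty_upto (eps T : R) (phi : R -> V) : Prop :=
  Linfty_loc T phi /\
  has_ubound [set t `^ eps * `|phi t| | t in `]0, T]].

(* Functions on (0, oo) are represented by total functions, whose values at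
   nonpositive times are irrelevant. *)
Definition weighted_Linfty (eps : R) (phi : R -> V) : Prop :=
  forall T : R, 0 < T -> weighted_Linfty_upto eps T phi.

End Bochner.

Section Smoothing.
Context {R : realType} {J : Type} (X : banach_scale R J).

Definition reg_diff (g' g : J) : R := regularity X g' - regularity X g.

(* [F g t u] is the value of the operator with index [t] at [u \in X^g]; it is
   only required to be an element of the ambient space, and in which spaces of
   the scale it lies is expressed by [smooths]. *)
Definition op_family := forall g : J, R -> banach_at X g -> ambient X.

Definition consistent_family (F : op_family) : Prop :=
  [/\ forall (g : J) (t : R), 0 <= t -> linear (F g t),
      forall (g : J) (u : banach_at X g), F g 0 u = emb X g u
    & forall (g g' : J) (u : banach_at X g) (u' : banach_at X g') (t : R), 0 <= t ->
        emb X g u = emb X g' u' -> F g t u = F g' t u'].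

(* The element of X^g equal to [e], when [e] lies in X^g. *)
Definition in_space (g : J) (e : ambient X) : banach_at X g :=
  xget 0 [set x | emb X g x = e].

Definition smooths (F : op_family) (g g' : J) : Prop :=
  0 <= reg_diff g' g /\
  exists M : R -> R,
    (forall T1 T2 : R, 0 < T1 -> T1 <= T2 -> M T1 <= M T2) /\
    forall T t : R, 0 < T -> 0 < t -> t <= T ->
      forall u : banach_at X g, exists2 x : banach_at X g', emb X g' x = F g t u &
        `|x| <= M T * t `^ (- reg_diff g' g) * `|u|.

Definition continuously_smooths (F : op_family) (g g' : J) : Prop :=
  smooths F g g' /\
  forall u : banach_at X g,
    {within `]0, +oo[, continuous (fun t : R => in_space g' (F g t u))}.

Definition perturbation_class (S : op_family) (al be : J) (rho : R)
    (P : banach_at X al -> banach_at X be) : Prop :=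
  [/\ 0 <= reg_diff al be < 1, continuously_smooths S be al,
      linear P & forall x : banach_at X al, `|P x| <= rho * `|x|].

Definition admissible (S : op_family) (al : J) : set J :=
  [set g | regularity X al - 1 < regularity X g <= regularity X al /\
           continuously_smooths S g al].

Section Perturbed.
Variables (S : op_family) (al : J) (n : nat) (be : 'I_n -> J).
Arguments S : clear implicits.
Variable P : forall i : 'I_n, banach_at X al -> banach_at X (be i).

Definition variation_of_constants (g : J) (u0 : banach_at X g)
    (u : R -> banach_at X al) : Prop :=
  forall t : R, 0 < t ->
    exists I : 'I_n -> banach_at X al,
      (forall i, is_bochner_integral 0 t
         (fun tau => in_space al (S (be i) (t - tau) (P i (u tau)))) (I i)) /\
      u t = in_space al (S g t u0) + \sum_(i < n) I i.

Definition solution (g : J) (u0 : banach_at X g)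
    (u : R -> banach_at X al) : Prop :=
  weighted_Linfty (reg_diff al g) u /\ variation_of_constants u0 u.

Definition perturbed_family : op_family := fun g t u0 =>
  if t == 0 then emb X g u0
  else emb X al (xget (fun=> 0) [set u | solution u0 u] t).

End Perturbed.

End Smoothing.

Arguments perturbed_family {R J X} S {al n be} P g t u0.

(* Main.v *)
Require Import Defs.
From HB Require Import structures.
From mathcomp Require Import all_boot all_order all_algebra.
From mathcomp Require Import all_classical all_reals all_analysis.
From mathcomp Require Import measurable_realfun ring lra.

Import Order.TTheory GRing.Theory Num.Theory.
Import numFieldNormedType.Exports.

Local Open Scope classical_set_scope.
Local Open Scope ring_scope.

(** Write [A i t x] for [S (be i) t (P i x)] seen in X^al, and [h t] for
    [S g t u0] seen in X^al. The equation is then a linear Volterra equation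
    in the single space X^al,

      u t = h t + \sum_i \int_0^t A i (t - x) (u x) dx,

    whose kernels are strongly continuous on t > 0 and of norm at most
    C * t ^ (- d) on each (0, T], for one exponent d < 1 common to all i
    ([perturbation_kernel]), and whose forcing term is at most m * t ^ (- e)
    with e = reg_diff al g < 1. Both singularities are integrable, and all the
    claims follow from one estimate.

    The estimate is [kernel_contraction]. Measured against the weight
    W t = t ^ (- e) * expR (lam * t) on (0, T], the integral operator halves
    the supremum once lam is large. The reason is that, for a small p > 0,
    expR (- lam * s) * s ^ (- d) <= lam ^ (- p) * s ^ (- (d + p)): a slightly
    worse but still integrable singularity buys the small factor lam ^ (- p),
    and what remains is a beta integral ([exp_weighted_kernel_le]).

    Consequently a solution satisfies |u| <= 2 m W ([volterra_apriori]), with a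
    constant that depends on T and on the kernels but not on the data. Applied
    to the difference of two solutions, this bound is uniqueness; applied to
    u_(c x + y) - c u_x - u_y, it is linearity; applied to one solution with
    m = C * |u0|, it is the smoothing estimate for the perturbed family. The
    same estimate makes the Picard iterates converge geometrically, uniformly
    with respect to W ([volterra_exists]). The iterates are continuous on
    (0, +oo), and so is their limit, which is the strong continuity claimed for
    the perturbed family.

    Two facts on Bochner integrals are needed. The first is that the norm of
    the integral is at most the integral of any function dominating the norm of
    the integrand ([bochner_ae_norm_le]). The second is that a continuous
    integrand with integrable singularities at both ends of (0, t) is
    integrable, with the integral given as a limit of Riemann sums
    ([bochner_integral_exists]). Riemann sums commute with the dilation of
    (0, 1) onto (0, t); hence the integral over (0, t) is t times an integral
    over the fixed interval (0, 1), and its continuity in t is a matter of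
    dominated convergence ([duhamel_continuous]). *)

Set Implicit Arguments.
Unset Strict Implicit.
Unset Printing Implicit Defensive.

Local Notation mu := (@lebesgue_measure _).

(** * Integrals of simple functions *)

Lemma measure_itvooI_fin_num (R : realType) (a b : R) (A : set R) :
  measurable (A : set (measurableTypeR R)) -> mu (`]a, b[ `&` A) \is a fin_num.
Proof.
move=> mA; rewrite ge0_fin_numE//.
apply: (@le_lt_trans _ _ (mu `]a, b[)).
  by apply: le_measure; rewrite ?inE//; exact: measurableI.
by rewrite lebesgue_measure_itv/=; case: ifP => // _; rewrite -EFinD ltry.
Qed.

(** The finite additivity behind every computation with simple integrals: a set
    that only depends on [h] is a disjoint union of fibers of [h]. *)
Lemma fine_measure_fibers (R : realType) (T : choiceType) (a b : R)
    (h : R -> T) (D : seq T) (P : pred T) :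
  uniq D -> (forall t, h t \in D) ->
  (forall w, measurable (h @^-1` [set w] : set (measurableTypeR R))) ->
  fine (mu (`]a, b[ `&` [set t | P (h t)])) =
  \sum_(w <- D | P w) fine (mu (`]a, b[ `&` h @^-1` [set w])).
Proof.
move=> uD hD mh.
pose D' := [set` (fun w => (w \in D) && P w)].
have -> : `]a, b[ `&` [set t | P (h t)] =
    \bigcup_(w in D') (`]a, b[ `&` h @^-1` [set w]).
  apply/seteqP; split => [t [abt Pt]|t [w /andP[wD Pw] [abt htw]]] /=.
    by exists (h t) => //; apply/andP.
  by split => //=; rewrite htw.
have finD' : finite_set D'.
  by apply: (@sub_finite_set _ _ [set` D]) => // w /andP[].
rewrite measure_fin_bigcup//; last 2 first.
- by move=> w w' _ _ [t [[_ /= <-] [_ /= <-]]].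
- by move=> w _; apply: (@measurableI _ (measurableTypeR R)) => //; exact:
      measurable_itv.
rewrite sum_fine; last by move=> w _; exact: measure_itvooI_fin_num.
congr fine; rewrite -(@bigfs _ _ _ _ D)//; last by move=> i /andP[+ _] /negP.
by rewrite [RHS]big_seq_cond; apply: eq_bigl => w; rewrite andbC.
Qed.

(** A simple integral may be computed on any finite partition on which the
    function is constant, not only on the partition into its own fibers. Taking
    [h] to be a pair of simple functions puts both on a common partition, which
    yields additivity. *)
Lemma simple_integral_factor (R : realType) (V : completeNormedModType R)
    (T : choiceType) (a b : R) (h : R -> T) (F : T -> V) (D : seq T) :
  uniq D -> (forall t, h t \in D) ->
  (forall w, measurable (h @^-1` [set w] : set (measurableTypeR R))) ->
  simple_integral a b (F \o h) =
  \sum_(w <- D) fine (mu (`]a, b[ `&` h @^-1` [set w])) *: F w.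
Proof.
move=> uD hD mh; rewrite /simple_integral.
pose L := undup (map F D).
rewrite (fsbigE L)/=; [|exact: undup_uniq|by []|]; last first.
  move=> v _; rewrite mem_undup => vL.
  rewrite [X in mu X](_ : _ = set0) ?measure0 ?scale0r//.
  apply/seteqP; split => // t [_ /= Fht]; move: vL; rewrite -Fht.
  by rewrite map_f.
rewrite (eq_bigl xpredT); last by move=> v; rewrite in_setT.
transitivity (\sum_(v <- L) \sum_(w <- D | F w == v)
    fine (mu (`]a, b[ `&` h @^-1` [set w])) *: F w).
  apply: eq_bigr => v _.
  rewrite (_ : (F \o h) @^-1` [set v] = [set t | (fun w => F w == v) (h t)]); last
      first.
    by apply/seteqP; split => t /= /eqP.
  rewrite (@fine_measure_fibers _ _ a b h D (fun w => F w == v))// scaler_suml.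
  by apply: eq_bigr => w /eqP ->.
rewrite (exchange_big_dep xpredT)//=; apply: eq_big_seq => w wD.
rewrite -big_filter (_ : [seq v <- L | F w == v] = [:: F w]) ?big_seq1//.
rewrite (eq_filter (a2 := pred1 (F w))); last by move=> v; rewrite /= eq_sym.
by rewrite filter_pred1_uniq ?undup_uniq// mem_undup map_f.
Qed.

Lemma simple_function_values (R : realType) (V : completeNormedModType R)
    (s : R -> V) : simple_function s ->
  exists2 D : seq V, uniq D & forall t, s t \in D.
Proof.
move=> [/finite_seqP[D hD] _]; exists (undup D); first exact: undup_uniq.
move=> t; rewrite mem_undup; have : [set` D] (s t) by rewrite -hD; exists t.
by [].
Qed.

Lemma simple_function_factor (R : realType) (V : completeNormedModType R)
    (T : choiceType) (h : R -> T) (F : T -> V) (D : seq T) :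
  (forall t, h t \in D) ->
  (forall w, measurable (h @^-1` [set w] : set (measurableTypeR R))) ->
  simple_function (F \o h).
Proof.
move=> hD mh; split.
  apply: (@sub_finite_set _ _ [set` map F D]); last exact: finite_seq.
  by move=> _ [t _ <-] /=; exact: map_f.
move=> v; rewrite (_ : _ @^-1` _ = \bigcup_(w in [set w | w \in D /\ F w = v]) h
    @^-1` [set w]).
  apply: fin_bigcup_measurable => //.
  by apply: (@sub_finite_set _ _ [set` D]) => // w [].
apply/seteqP; split=> [t <-|t [w [_ <-] <-]//] /=.
by exists (h t).
Qed.

Lemma simple_function_measurable (R : realType) (V : completeNormedModType R)
    (s : R -> V) (G : V -> R) : simple_function s ->
  measurable_fun [set: measurableTypeR R] (fun t => G (s t) : R).
Proof.
move=> ss; have [D uD sD] := simple_function_values ss.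
move=> _ Y mY; rewrite setTI.
rewrite (_ : _ @^-1` _ = \bigcup_(w in [set w | w \in D /\ Y (G w)]) s @^-1` [set w]).
  apply: fin_bigcup_measurable => [|w _]; last by case: ss.
  by apply: (@sub_finite_set _ _ [set` D]) => // w [].
apply/seteqP; split=> [t Yt|t [w [_ Yw] /= ->]//].
by exists (s t).
Qed.

Lemma simple_pair_fibers (R : realType) (V : completeNormedModType R)
    (s s' : R -> V) : simple_function s -> simple_function s' ->
  exists2 D : seq (V * V), uniq D & (forall t, (s t, s' t) \in D) /\
  (forall w, measurable ((fun t => (s t, s' t)) @^-1` [set w]
     : set (measurableTypeR R))).
Proof.
move=> ss ss'; have [D uD sD] := simple_function_values ss.
have [D' uD' sD'] := simple_function_values ss'.
(* All pairs of values, including pairs with an empty fiber. *)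
exists [seq (x, y) | x <- D, y <- D'].
  by apply: allpairs_uniq => // -[? ?] [? ?] _ _ [-> ->].
split=> [t|[v v']]; first exact: allpairs_f.
rewrite (_ : _ @^-1` _ = s @^-1` [set v] `&` s' @^-1` [set v']).
  by apply: measurableI; [case: ss|case: ss'].
by apply/seteqP; split=> t /= [-> ->].
Qed.

Lemma simple_function_linear (R : realType) (V : completeNormedModType R) (c : R)
    (s s' : R -> V) : simple_function s -> simple_function s' ->
  simple_function (fun t => c *: s t + s' t).
Proof.
move=> ss ss'; have [D uD [hD mD]] := simple_pair_fibers ss ss'.
exact: (simple_function_factor (fun w => c *: w.1 + w.2) hD mD).
Qed.

Lemma simple_integral_linear (R : realType) (V : completeNormedModType R) (a b c : R)
    (s s' : R -> V) : simple_function s -> simple_function s' ->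
  simple_integral a b (fun t => c *: s t + s' t) =
  c *: simple_integral a b s + simple_integral a b s'.
Proof.
move=> ss ss'; have [D uD [hD mD]] := simple_pair_fibers ss ss'.
have E (F : V * V -> V) := simple_integral_factor a b F uD hD mD.
rewrite [LHS](E (fun w => c *: w.1 + w.2)).
rewrite [simple_integral a b s](E fst) [simple_integral a b s'](E snd).
rewrite scaler_sumr -big_split/=; apply: eq_bigr => w _.
by rewrite scalerDr !scalerA mulrC.
Qed.

Lemma norm_simple_integral (R : realType) (V : completeNormedModType R)
    (a b : R) (s : R -> V) : simple_function s ->
  (`|simple_integral a b s|%:E <= \int[mu]_(t in `]a, b[) (`|s t|)%:E)%E.
Proof.
move=> ss; have [D uD sD] := simple_function_values ss.
have ms w : measurable (s @^-1` [set w] : set (measurableTypeR R)) by case: ss.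
rewrite [simple_integral a b s](@simple_integral_factor _ _ _ a b s id D)//.
have -> : (\int[mu]_(t in `]a, b[) (`|s t|)%:E =
    \int[mu]_(t in `]a, b[) \sum_(w <- D) (`|w| * \1_(s @^-1` [set w]) t)%:E)%E.
  apply: eq_integral => t _; rewrite sumEFin (bigD1_seq (s t))//=.
  rewrite indicE mem_set// mulr1 big1 ?addr0// => w ws.
  by rewrite indicE memNset ?mulr0//= => /esym/eqP; rewrite (negbTE ws).
rewrite ge0_integral_sum//; last first.
  move=> w; apply/measurable_EFinP; exact: measurable_funM.
rewrite (eq_bigr (fun w => (`|w| * fine (mu (`]a, b[ `&` s @^-1` [set w])))%:E)).
  rewrite sumEFin lee_fin; apply: (le_trans (ler_norm_sum _ _ _)).
  apply: ler_sum => w _; rewrite normrZ ger0_norm ?fine_ge0//.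
  by rewrite mulrC.
move=> w _; under eq_integral do rewrite EFinM.
rewrite ge0_integralZl_EFin//=; last exact/measurable_EFinP.
rewrite integral_indic// setIC EFinM fineK//.
exact: measure_itvooI_fin_num.
Qed.

(** * Norm estimate for the Bochner integral *)

(** Pointwise limits everywhere on [E] of simple functions. Unlike a.e. limits,
    they are Borel measurable on [E] for Borel [E]. *)
Definition simple_limit (R : realType) (V : completeNormedModType R)
    (E : set R) (f : R -> V) : Prop :=
  exists2 s : nat -> R -> V, (forall n, simple_function (s n)) &
    forall t, E t -> s n t @[n --> \oo] --> f t.

(** The Bochner integral, up to a null set of times. A strongly measurable
    function is only an a.e. limit of simple functions, so that
    [`|f t - s n t|] need not be Borel measurable on the whole interval;
    discarding a Borel null set restores measurability, which additivity of the
    scalar integral requires. *)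
Definition bochner_ae (R : realType) (V : completeNormedModType R)
    (a b : R) (f : R -> V) (I : V) : Prop :=
  exists E : set (measurableTypeR R),
    [/\ measurable E, E `<=` `]a, b[, mu (`]a, b[ `\` E) = 0%E, simple_limit E f
    & exists s : nat -> R -> V,
      [/\ forall n, simple_function (s n),
          (\int[mu]_(t in E) (`|f t - s n t|)%:E)%E @[n --> \oo] --> 0%E
        & simple_integral a b (s n) @[n --> \oo] --> I]].

(** The integral of a nonnegative function is a supremum over the simple
    functions below it, hence monotone in the set even when the function is not
    measurable. *)
Lemma le_integral_subset (R : realType) (A B : set R) (k : R -> R) :
  (forall t, 0 <= k t) -> A `<=` B ->
  (\int[mu]_(t in A) (k t)%:E <= \int[mu]_(t in B) (k t)%:E)%E.
Proof.
move=> k0 AB; rewrite !ge0_integralE//; try by move=> t _; rewrite lee_fin.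
apply: le_ereal_sup => _ [h /= hk <-]; exists h => //= t.
apply: (le_trans (hk t)); rewrite !patchE.
case: ifPn => [/set_mem/AB/mem_set -> //|_]; case: ifP => // _.
by rewrite lee_fin.
Qed.

Lemma simple_limitS (R : realType) (V : completeNormedModType R)
    (E E' : set R) (f : R -> V) :
  E `<=` E' -> simple_limit E' f -> simple_limit E f.
Proof. by move=> EE' [s ss sf]; exists s => // t /EE'/sf. Qed.

Lemma simple_limit_simple (R : realType) (V : completeNormedModType R)
    (E : set R) (s : R -> V) : simple_function s -> simple_limit E s.
Proof. by move=> ss; exists (fun=> s) => // t _; exact: cvg_cst. Qed.

Lemma simple_limit_linear (R : realType) (V : completeNormedModType R)
    (E : set R) (c : R) (f g : R -> V) :
  simple_limit E f -> simple_limit E g ->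
  simple_limit E (fun t => c *: f t + g t).
Proof.
move=> [s ss sf] [s' ss' sg]; exists (fun n t => c *: s n t + s' n t).
  by move=> n; exact: simple_function_linear.
by move=> t Et; apply: cvgD; [apply: cvgZr; exact: sf|exact: sg].
Qed.

Lemma simple_limitB (R : realType) (V : completeNormedModType R)
    (E : set R) (f g : R -> V) :
  simple_limit E f -> simple_limit E g -> simple_limit E (fun t => f t - g t).
Proof.
move=> lf lg; have := simple_limit_linear (-1) lg lf.
by under eq_fun do rewrite scaleN1r addrC.
Qed.

Lemma simple_limit_measurable (R : realType) (V : completeNormedModType R)
    (E : set (measurableTypeR R)) (f : R -> V) : measurable E ->
  simple_limit E f -> measurable_fun E (fun t => `|f t| : R).
Proof.
move=> mE [s ss sf].
apply: (@measurable_fun_cvg _ _ _ E (fun n t => `|s n t|)).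
  move=> n; apply: (@measurable_funS _ _ _ _ setT) => //.
  exact: (simple_function_measurable _ (ss n)).
by move=> t Et; apply: cvg_norm; exact: sf.
Qed.

(** The exceptional set of the strong measurability of [f] is enclosed in a
    Borel null set, outside of which the limit holds everywhere. *)
Lemma is_bochner_integral_ae (R : realType) (V : completeNormedModType R)
    (a b : R) (f : R -> V) (I : V) :
  is_bochner_integral a b f I -> bochner_ae a b f I.
Proof.
move=> [[s0 ss0 [N [mN N0 sN]]] [s [ss fs sI]]].
exists (`]a, b[ `\` N); split.
- by apply: measurableD => //; exact: measurable_itv.
- by move=> t [].
- apply/eqP; rewrite -measure_le0 -N0; apply: le_measure; rewrite ?inE//.
    by apply: measurableD; [exact: measurable_itv|apply: measurableD => //; exact:
        measurable_itv].
  by move=> t [abt /not_andP[//|/contrapT]].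
- exists s0 => // t [abt Nt]; have := subsetC sN Nt.
  by rewrite setCK; apply.
exists s; split => //.
apply: (squeeze_cvge _ (cvg_cst _) fs); apply: nearW => n.
rewrite integral_ge0/=; last by move=> t _; rewrite lee_fin.
by apply: le_integral_subset => [t|t []].
Qed.

Lemma bochner_ae_linear (R : realType) (V : completeNormedModType R)
    (a b c : R) (f g : R -> V) (I I' : V) :
  bochner_ae a b f I -> bochner_ae a b g I' ->
  bochner_ae a b (fun t => c *: f t + g t) (c *: I + I').
Proof.
move=> [E [mE Eab E0 lf [s [ss fs sI]]]] [E' [mE' E'ab E'0 lg [s' [ss' gs sI']]]].
have mab : measurable (`]a, b[ : set (measurableTypeR R)) by exact: measurable_itv.
have mEE' : measurable (E `&` E') by exact: measurableI.
have lf' := simple_limitS (@subIsetl _ E E') lf.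
have lg' := simple_limitS (@subIsetr _ E E') lg.
exists (E `&` E'); split => //.
- by move=> t [/Eab].
- rewrite setDIr; apply: null_set_setU => //; exact: measurableD.
- exact: simple_limit_linear.
exists (fun n t => c *: s n t + s' n t); split.
- by move=> n; exact: simple_function_linear.
- have mfs n : measurable_fun (E `&` E') (fun t => (`|f t - s n t|)%:E).
    apply/measurable_EFinP; apply: simple_limit_measurable => //.
    by apply: simple_limitB => //; exact: simple_limit_simple.
  have mgs n : measurable_fun (E `&` E') (fun t => (`|g t - s' n t|)%:E).
    apply/measurable_EFinP; apply: simple_limit_measurable => //.
    by apply: simple_limitB => //; exact: simple_limit_simple.
  apply: (@squeeze_cvge _ _ _ _ (fun=> 0%E) _ (fun n =>
      (`|c|%:E * \int[mu]_(t in E) (`|f t - s n t|)%:E +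
      \int[mu]_(t in E') (`|g t - s' n t|)%:E)%E)); last 2 first.
  + exact: cvg_cst.
  + rewrite -[X in _ --> X](_ : (`|c|%:E * 0 + 0 = 0)%E); last by rewrite mule0 add0e.
    apply: cvgeD => //.
    by apply: cvgeZl.
  apply: nearW => n; rewrite integral_ge0/=; last by move=> t _; rewrite lee_fin.
  apply: (@le_trans _ _ (\int[mu]_(t in E `&` E')
      (`|c|%:E * (`|f t - s n t|)%:E + (`|g t - s' n t|)%:E)))%E.
    apply: ge0_le_integral => //.
    + apply/measurable_EFinP; apply: simple_limit_measurable => //.
      apply: simple_limitB; first exact: simple_limit_linear.
      by apply: simple_limit_simple; exact: simple_function_linear.
    + apply: emeasurable_funD => //; apply: measurable_funeM; exact: mfs.
    move=> t _; rewrite -EFinM -EFinD lee_fin -normrZ.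
    apply: le_trans (ler_normD _ _); rewrite scalerBr.
    by rewrite opprD addrACA.
  rewrite ge0_integralD//; last first.
    by apply: measurable_funeM; exact: mfs.
  rewrite ge0_integralZl_EFin//; apply: leeD.
    apply: lee_wpmul2l; first by rewrite lee_fin.
    exact: le_integral_subset.
  exact: le_integral_subset.
- under eq_cvg do rewrite simple_integral_linear//.
  by apply: cvgD => //; apply: cvgZr.
Qed.

(** Pass to the limit in
    [`|simple_integral (s n)| <= \int `|s n| <= \int `|f - s n| + \int phi]. *)
Lemma bochner_ae_norm_le (R : realType) (V : completeNormedModType R)
    (a b : R) (f : R -> V) (I : V) (phi : R -> R) :
  bochner_ae a b f I ->
  measurable_fun (`]a, b[ : set (measurableTypeR R)) phi ->
  (forall t, a < t < b -> `|f t| <= phi t) ->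
  (`|I|%:E <= \int[mu]_(t in `]a, b[) (phi t)%:E)%E.
Proof.
move=> [E [mE Eab E0 lf [s [ss fs sI]]]] mphi fphi.
have mab : measurable (`]a, b[ : set (measurableTypeR R)) by exact: measurable_itv.
have phi0 t : `]a, b[%classic t -> 0 <= phi t.
  by rewrite /= in_itv => /fphi; apply: le_trans.
have EN k : measurable_fun (`]a, b[ : set (measurableTypeR R)) k ->
    (forall t, `]a, b[%classic t -> (0 <= k t)%E) ->
    (\int[mu]_(t in `]a, b[) k t = \int[mu]_(t in E) k t)%E.
  move=> mk k0; have mN : measurable (`]a, b[ `\` E : set (measurableTypeR R)) by
      exact: measurableD.
  have := @ge0_negligible_integral _ _ R mu _ _ k mN mab mk k0 E0.
  by rewrite setDD setIidr.
have key n : (`|simple_integral a b (s n)|%:E <=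
    \int[mu]_(t in E) (`|f t - s n t|)%:E + \int[mu]_(t in `]a, b[) (phi t)%:E)%E.
  apply: (le_trans (norm_simple_integral _ _ (ss n))).
  rewrite !EN//; last 2 first.
  + exact/measurable_EFinP.
  + apply/measurable_EFinP; apply: (@measurable_funS _ _ _ _ setT) => //.
    exact: (simple_function_measurable _ (ss n)).
  rewrite -ge0_integralD//; last 3 first.
  + apply/measurable_EFinP; apply: simple_limit_measurable => //.
    by apply: simple_limitB => //; exact: simple_limit_simple.
  + by move=> t /Eab/phi0; rewrite lee_fin.
  + by apply/measurable_EFinP; exact: measurable_funS mphi.
  apply: ge0_le_integral => //.
  + apply/measurable_EFinP; apply: (@measurable_funS _ _ _ _ setT) => //.
    exact: (simple_function_measurable _ (ss n)).
  + apply: emeasurable_funD; apply/measurable_EFinP.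
      apply: simple_limit_measurable => //.
      by apply: simple_limitB => //; exact: simple_limit_simple.
    exact: measurable_funS mphi.
  move=> t /Eab abt; rewrite -EFinD lee_fin.
  rewrite -lerBlDr; apply: le_trans (_ : `|s n t| - `|f t| <= _).
    by rewrite lerD2l lerN2; apply: fphi; move: abt; rewrite /= in_itv.
  by rewrite distrC; exact: lerB_dist.
have L : (`|simple_integral a b (s n)|%:E @[n --> \oo] --> `|I|%:E)%E.
  by apply: cvg_EFin; [exact: nearW|apply: cvg_norm].
have Rl : (\int[mu]_(t in E) (`|f t - s n t|)%:E +
    \int[mu]_(t in `]a, b[) (phi t)%:E)%E @[n --> \oo] -->
    (\int[mu]_(t in `]a, b[) (phi t)%:E)%E.
  rewrite -[X in _ --> X]add0e; by apply: cvgeD => //; exact: cvg_cst.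
rewrite -(cvg_lim _ L)// -(cvg_lim _ Rl)//; apply: lee_lim.
- exact: cvgP L.
- exact: cvgP Rl.
- exact: nearW.
Qed.

(** * Weakly singular scalar integrals *)

(** Exhaust ]a, b[ by closed intervals on which the fundamental theorem of
    calculus applies; bounding the increments of [F] avoids computing its limits
    at the endpoints. *)
Lemma improper_integral_le (R : realType) (f F : R -> R) (a b B : R) :
  a < b ->
  (forall x, a < x < b -> 0 <= f x) ->
  (forall x, a < x < b -> {for x, continuous f}) ->
  (forall x, a < x < b -> is_derive x (1 : R) F (f x)) ->
  (forall x y, a < x < y -> y < b -> F y - F x <= B) ->
  (\int[mu]_(t in `]a, b[) (f t)%:E <= B%:E)%E.
Proof.
move=> ab f0 cf dF FB.
(* n.+3 makes 2 * de n < b - a, so that the intervals are nondegenerate. *)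
pose de (n : nat) := (b - a) / n.+3%:R.
have ba0 : 0 < b - a by rewrite subr_gt0.
have de0 n : 0 < de n by rewrite divr_gt0.
have de2 n : a + de n < b - de n.
  rewrite -subr_gt0 (_ : _ - _ = (b - a) * (1 - 2 / n.+3%:R)); last first.
    rewrite /de; set N : R := n.+3%:R.
    have N0 : N != 0 by rewrite pnatr_eq0.
    by field.
  by rewrite mulr_gt0// subr_gt0 ltr_pdivrMr// mul1r ltr_nat.
pose D (n : nat) : set (measurableTypeR R) := `[a + de n, b - de n]%classic.
have Dab n x : D n x -> a < x < b.
  rewrite /D /= in_itv/= => /andP[ax xb]; apply/andP; split.
    by apply: lt_le_trans ax; rewrite ltrDl.
  by apply: (le_lt_trans xb); rewrite gtrDl oppr_lt0.
have Dcup : `]a, b[%classic = \bigcup_n D n.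
  apply/seteqP; split => [x|x [n _ /Dab]]; rewrite /= in_itv//=.
  move=> /andP[ax xb].
  pose m := Num.min (x - a) (b - x).
  have m0 : 0 < m by rewrite lt_min !subr_gt0 ax.
  have [n _ /(_ n (leqnn n)) nm] := near_infty_natSinv_lt (PosNum (divr_gt0 m0 ba0)).
  have dm : de n <= m.
    rewrite /de mulrC -ler_pdivlMr//; apply: le_trans (ltW nm).
    by rewrite lef_pV2 ?posrE// ler_nat !ltnS ltnW.
  exists n => //; rewrite /D /= in_itv/=; move: dm; rewrite le_min => /andP[d1 d2].
  by apply/andP; split; lra.
have Dc n : {within D n, continuous f}.
  apply: continuous_in_subspaceT => x /set_mem /Dab xab; exact: cf.
have L : (\int[mu]_(t in D n) (f t)%:E @[n --> \oo] -->
    \int[mu]_(t in \bigcup_n D n) (f t)%:E)%E.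
  apply: ge0_nondecreasing_set_cvg_integral => //.
  - move=> n m nm; apply/subsetPset; apply: subset_itv; rewrite bnd_simp.
      by rewrite lerD2l ler_pM2l// lef_pV2 ?posrE// ler_nat.
    by rewrite lerD2l lerN2 ler_pM2l// lef_pV2 ?posrE// ler_nat.
  - by move=> n; exact: measurable_itv.
  - move=> n; apply/measurable_EFinP; apply: subspace_continuous_measurable_fun => //.
    exact: measurable_itv.
  - by move=> n x /Dab/f0; rewrite lee_fin.
rewrite Dcup; apply: (cvge_to_le L); apply: nearW => n.
have dFn x : x \in `]a + de n, b - de n[ -> is_derive x (1 : R) F (f x).
  by move=> xD; apply: dF; apply: (@Dab n); apply: subset_itv_oo_cc.
have dFn' x : D n x -> is_derive x (1 : R) F (f x) by move=> /Dab/dF.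
rewrite (@continuous_FTC2 _ f F)//; last 3 first.
- exact: Dc.
- have Fc : {within D n, continuous F}.
    apply: derivable_within_continuous => x xD.
    by have /@ex_derive := dFn' x xD.
  split.
  + by move=> x xD; have /@ex_derive := dFn x xD.
  + by have /(continuous_within_itvP _ (de2 n))[] := Fc.
  + by have /(continuous_within_itvP _ (de2 n))[] := Fc.
- by move=> x xD; rewrite derive1E; have /@derive_val := dFn x xD.
rewrite -EFinD lee_fin FB//.
  by rewrite ltrDl de0 de2.
by rewrite gtrDl oppr_lt0.
Qed.

Lemma integral_powR_le (R : realType) (e t : R) : e < 1 -> 0 < t ->
  (\int[mu]_(x in `]0%R, t[) (x `^ (- e))%:E <= (t `^ (1 - e) / (1 - e))%:E)%E.
Proof.
move=> e1 t0.
have e1' : 0 < 1 - e by rewrite subr_gt0.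
have dF (x : R) : 0 < x -> is_derive x (1 : R) ((1 - e)^-1 \*: (@powR R ^~ (1 -
    e))) (x `^ (- e)).
  move=> x0; have := is_deriveZ (1 - e)^-1 (is_derive1_powR (1 - e) x0).
  rewrite scalerA mulVf ?gt_eqF// scale1r.
  by rewrite (_ : 1 - e - 1 = - e) //; ring.
apply: (@improper_integral_le _ _ ((1 - e)^-1 \*: (@powR R ^~ (1 - e)))) => //.
- by move=> x _; exact: powR_ge0.
- move=> x /andP[x0 _].
  apply: differentiable_continuous; apply/derivable1_diffP.
  by apply: derivable_powR; rewrite in_itv/= andbT.
- by move=> x /andP[x0 _]; exact: dF.
move=> x y /andP[x0 xy] yt.
have yt' : y `^ (1 - e) <= t `^ (1 - e).
  by rewrite ge0_ler_powR ?nnegrE ?ltW// (lt_trans x0).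
have := powR_ge0 x (1 - e); have : 0 < (1 - e)^-1 by rewrite invr_gt0.
by rewrite /= /GRing.scale/=; nra.
Qed.

Lemma integral_powRB_le (R : realType) (e t : R) : e < 1 -> 0 < t ->
  (\int[mu]_(x in `]0%R, t[) ((t - x) `^ (- e))%:E <= (t `^ (1 - e) / (1 - e))%:E)%E.
Proof.
move=> e1 t0.
have e1' : 0 < 1 - e by rewrite subr_gt0.
have dB (x : R) : is_derive x (1 : R) (fun y => t - y) (- 1).
  have := is_deriveB (is_derive_cst t x (1 : R)) (is_derive_id x (1 : R)).
  by rewrite sub0r.
pose F := - ((1 - e)^-1 \*: ((@powR R ^~ (1 - e)) \o (fun y => t - y))).
have dF (x : R) : 0 < t - x -> is_derive x (1 : R) F ((t - x) `^ (- e)).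
  move=> x0; have D1 := @is_derive1_comp _ _ (fun y => t - y) _ _ _
      (is_derive1_powR (1 - e) x0) (dB x).
  have := is_deriveN (is_deriveZ (1 - e)^-1 D1).
  rewrite mulrN1 scalerN opprK scalerA mulVf ?gt_eqF// scale1r.
  by rewrite (_ : 1 - e - 1 = - e) //; ring.
apply: (@improper_integral_le _ _ F) => //.
- by move=> x _; exact: powR_ge0.
- move=> x /andP[_ xt]; apply: (@continuous_comp _ _ _ (fun y => t - y) (@powR R ^~
      (- e))).
    by apply: differentiable_continuous; apply/derivable1_diffP; have /@ex_derive
        := dB x.
  apply: differentiable_continuous; apply/derivable1_diffP.
  by apply: derivable_powR; rewrite in_itv/= andbT subr_gt0.
- by move=> x /andP[_ xt]; apply: dF; rewrite subr_gt0.
move=> x y /andP[x0 xy] yt.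
have xt' : (t - x) `^ (1 - e) <= t `^ (1 - e).
  by rewrite ge0_ler_powR ?nnegrE ?gerBl ?ltW// subr_gt0 (lt_trans xy).
have := powR_ge0 (t - y) (1 - e); have : 0 < (1 - e)^-1 by rewrite invr_gt0.
have FE z : F z = - ((1 - e)^-1 * (t - z) `^ (1 - e)) by [].
by rewrite !FE; nra.
Qed.

Lemma measurable_beta_weight (R : realType) (d e t : R) (D : set R) :
  measurable (D : set (measurableTypeR R)) ->
  measurable_fun (D : set (measurableTypeR R))
    (fun x => (t - x) `^ (- d) * x `^ (- e) : R).
Proof.
move=> mD; apply: (@measurable_funS _ _ _ _ setT) => //.
apply: measurable_funM => //.
by apply: (measurableT_comp (measurable_powR (- d))); exact: measurable_funB.
Qed.

Lemma gt0_ler_powRN (R : realType) (p y z : R) : 0 <= p -> 0 < y -> y <= z ->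
  z `^ (- p) <= y `^ (- p).
Proof.
move=> p0 y0 yz; rewrite !powRN lef_pV2 ?posrE ?powR_gt0 ?(lt_le_trans y0)//.
by rewrite ge0_ler_powR// nnegrE ltW// (lt_le_trans y0).
Qed.

(** One of x and t - x is at least t / 2, so one of the two singular factors is
    at most its value at t / 2. *)
Lemma beta_weight_split (R : realType) (d e t x : R) :
  0 <= d -> 0 <= e -> 0 < x < t ->
  (t - x) `^ (- d) * x `^ (- e) <=
  (t / 2) `^ (- d) * x `^ (- e) + (t / 2) `^ (- e) * (t - x) `^ (- d).
Proof.
move=> d0 e0 /andP[x0 xt].
have [xt2|xt2] := leP x (t / 2).
  apply: ler_wpDr; first by rewrite mulr_ge0 ?powR_ge0.
  rewrite ler_wpM2r ?powR_ge0// gt0_ler_powRN//; first by rewrite divr_gt0//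
      (lt_trans x0).
  lra.
apply: ler_wpDl; first by rewrite mulr_ge0 ?powR_ge0.
rewrite mulrC ler_wpM2r ?powR_ge0// gt0_ler_powRN// ?ltW//.
by rewrite divr_gt0// (lt_trans x0).
Qed.

(** The two terms of [beta_weight_split] integrate to multiples of
    t ^ (1 - d - e). *)
Lemma integral_beta_weight_le (R : realType) (d e : R) :
  0 <= d < 1 -> 0 <= e < 1 ->
  exists2 B : R, 0 < B & forall t, 0 < t ->
  (\int[mu]_(x in `]0%R, t[) ((t - x) `^ (- d) * x `^ (- e))%:E <=
     (B * t `^ (1 - d) * t `^ (- e))%:E)%E.
Proof.
move=> /andP[d0 d1] /andP[e0 e1].
exists (2 `^ d / (1 - e) + 2 `^ e / (1 - d)).
  by rewrite addr_gt0// divr_gt0 ?powR_gt0 ?subr_gt0.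
move=> t t0.
have mI : measurable (`]0%R, t[%classic : set (measurableTypeR R)).
  exact: measurable_itv.
have mp (p : R) : measurable_fun (`]0%R, t[ : set (measurableTypeR R)) (fun x => x
    `^ p : R).
  by apply: (@measurable_funS _ _ _ _ setT) => //; exact: measurable_powR.
have mpB (p : R) : measurable_fun (`]0%R, t[ : set (measurableTypeR R)) (fun x =>
    (t - x) `^ p : R).
  apply: (@measurable_funS _ _ _ _ setT) => //.
  by apply: (measurableT_comp (measurable_powR p)); exact: measurable_funB.
apply: (@le_trans _ _ (\int[mu]_(x in `]0%R, t[)
    (((t / 2) `^ (- d))%:E * (x `^ (- e))%:E +
     ((t / 2) `^ (- e))%:E * ((t - x) `^ (- d))%:E))%E).
  apply: ge0_le_integral => //.
  - by move=> x _; rewrite lee_fin mulr_ge0 ?powR_ge0.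
  - by apply/measurable_EFinP; exact: measurable_beta_weight.
  - apply: emeasurable_funD; apply: measurable_funeM; exact/measurable_EFinP.
  by move=> x; rewrite /= in_itv/= -!EFinM -EFinD lee_fin => /beta_weight_split->.
rewrite ge0_integralD//; last 4 first.
- by move=> x _; rewrite -EFinM lee_fin mulr_ge0 ?powR_ge0.
- by apply: measurable_funeM; exact/measurable_EFinP.
- by move=> x _; rewrite -EFinM lee_fin mulr_ge0 ?powR_ge0.
- by apply: measurable_funeM; exact/measurable_EFinP.
rewrite !ge0_integralZl_EFin ?powR_ge0//; try exact/measurable_EFinP;
  try by move=> x _; rewrite lee_fin powR_ge0.
apply: (@le_trans _ _ (((t / 2) `^ (- d))%:E * (t `^ (1 - e) / (1 - e))%:E +
  ((t / 2) `^ (- e))%:E * (t `^ (1 - d) / (1 - d))%:E)%E).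
  apply: leeD; apply: lee_wpmul2l; rewrite ?lee_fin ?powR_ge0//.
    exact: integral_powR_le.
  exact: integral_powRB_le.
rewrite -!EFinM -EFinD lee_fin le_eqVlt; apply/orP; left; apply/eqP.
have half p : (t / 2) `^ (- p) = 2 `^ p * t `^ (- p).
  by rewrite powRM ?invr_ge0 ?ltW// -powR_inv1// -powRrM mulrNN mul1r mulrC.
have pw p : t `^ (1 - p) = t * t `^ (- p).
  by rewrite powRD ?powRr1 ?ltW// (gt_eqF t0) implybT.
by rewrite !half !pw; ring.
Qed.

Lemma powR_le_expR (R : realType) (p x : R) : 0 <= p <= 1 -> 0 < x ->
  x `^ p <= expR x.
Proof.
move=> /andP[p0 p1] x0; rewrite /powR gt_eqF// ler_expR.
have := ln_sublinear x0; have [l0|l0] := leP 0 (ln x); nra.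
Qed.

(** With p = (1 - d) / 2, the bound (lam * s) ^ p <= expR (lam * s) at
    s = t - x turns s ^ (- d) * expR (- lam * s) into
    lam ^ (- p) * s ^ (- (d + p)). The exponent d + p is still below 1, and
    lam ^ (- p) is as small as needed. *)
Lemma exp_weighted_kernel_le (R : realType) (d e T eta : R) :
  0 <= d < 1 -> 0 <= e < 1 -> 0 < T -> 0 < eta ->
  exists2 lam : R, 0 <= lam & forall t, 0 < t <= T ->
  (\int[mu]_(x in `]0%R, t[) ((t - x) `^ (- d) * (x `^ (- e) * expR (lam * x)))%:E <=
     (eta * (t `^ (- e) * expR (lam * t)))%:E)%E.
Proof.
move=> /andP[d0 d1] e01 T0 eta0.
pose p := (1 - d) / 2; pose d' := d + p.
have d'01 : 0 <= d' < 1 by rewrite /d' /p; lra.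
have p01 : 0 < p <= 1 by rewrite /p; lra.
have p0 : 0 < p by case/andP: p01.
have [B B0 HB] := integral_beta_weight_le d'01 e01.
pose Q := B * T `^ (1 - d') / eta.
have Q0 : 0 < Q by rewrite !(divr_gt0, mulr_gt0) ?powR_gt0.
(* Chosen so that lam ^ p = Q + 1 > Q, where Q / lam ^ p <= 1 is the
   required smallness. *)
pose lam := (Q + 1) `^ p^-1.
have lam0 : 0 < lam by rewrite powR_gt0// addr_gt0.
have lamp : lam `^ p = Q + 1.
  by rewrite -powRrM mulVf ?gt_eqF// powRr1// ltW// addr_gt0.
exists lam => [|t /andP[t0 tT]]; first exact: ltW.
have mI : measurable (`]0%R, t[%classic : set (measurableTypeR R)).
  exact: measurable_itv.
have key x : 0 < x < t -> (t - x) `^ (- d) * (x `^ (- e) * expR (lam * x)) <=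
    (expR (lam * t) / (Q + 1)) * ((t - x) `^ (- d') * x `^ (- e)).
  move=> /andP[x0 xt]; have tx0 : 0 < t - x by rewrite subr_gt0.
  have -> : expR (lam * x) = expR (lam * t) / expR (lam * (t - x)).
    by rewrite -expRN -expRD; congr expR; ring.
  have : (lam * (t - x)) `^ p <= expR (lam * (t - x)).
    by apply: powR_le_expR; [rewrite ltW//; case/andP: p01|rewrite mulr_gt0].
  rewrite (powRM _ (ltW lam0) (ltW tx0)) lamp => le1.
  have tp0 : 0 < (t - x) `^ p by rewrite powR_gt0.
  rewrite /d' opprD powRD; last by rewrite (gt_eqF tx0) implybT.
  rewrite (powRN (t - x) p).
  rewrite (_ : _ / (Q + 1) * _ = (t - x) `^ (- d) * (x `^ (- e) *
    (expR (lam * t) / ((Q + 1) * (t - x) `^ p)))); last first.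
    by field; rewrite !gt_eqF//; lra.
  rewrite !ler_wpM2l ?powR_ge0 ?expR_ge0//.
  by rewrite lef_pV2 ?posrE ?expR_gt0 ?mulr_gt0//; lra.
have c0 : 0 <= expR (lam * t) / (Q + 1).
  by rewrite divr_ge0 ?expR_ge0// ltW// addr_gt0.
apply: (@le_trans _ _ (\int[mu]_(x in `]0%R, t[)
   ((expR (lam * t) / (Q + 1))%:E * ((t - x) `^ (- d') * x `^ (- e))%:E))%E).
  apply: ge0_le_integral => //.
  - by move=> x _; rewrite lee_fin !mulr_ge0 ?powR_ge0 ?expR_ge0.
  - apply/measurable_EFinP; apply: (@measurable_funS _ _ _ _ setT) => //.
    apply: measurable_funM.
      by apply: (measurableT_comp (measurable_powR (- d))); exact: measurable_funB.
    apply: measurable_funM => //.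
    by apply: (measurableT_comp (@measurable_expR R)); exact: measurable_funM.
  - by apply: measurable_funeM; apply/measurable_EFinP; exact: measurable_beta_weight.
rewrite ge0_integralZl_EFin//; last 2 first.
- by move=> x _; rewrite lee_fin mulr_ge0 ?powR_ge0.
- by apply/measurable_EFinP; exact: measurable_beta_weight.
apply: (@le_trans _ _ ((expR (lam * t) / (Q + 1))%:E * (B * t `^ (1 - d') * t `^ (-
    e))%:E)%E).
  by apply: lee_wpmul2l; [rewrite lee_fin|exact: HB].
rewrite -EFinM lee_fin.
have tT' : B * t `^ (1 - d') <= eta * (Q + 1).
  apply: (@le_trans _ _ (eta * Q)); last by rewrite ler_wpM2l ?ltW//; lra.
  have -> : eta * Q = B * T `^ (1 - d') by rewrite /Q; field; rewrite gt_eqF.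
  rewrite ler_pM2l//; apply: ge0_ler_powR => //; rewrite ?nnegrE ?(ltW t0) ?(ltW T0)//.
  by rewrite subr_ge0 ltW//; case/andP: d'01.
rewrite [X in X <= _](_ : _ = (expR (lam * t) * t `^ (- e)) * (B * t `^ (1 - d') /
    (Q + 1))); last first.
  by field; rewrite gt_eqF// addr_gt0.
rewrite [X in _ <= X](_ : _ = (expR (lam * t) * t `^ (- e)) * eta); last by ring.
by rewrite ler_wpM2l ?mulr_ge0 ?expR_ge0 ?powR_ge0// ler_pdivrMr// addr_gt0.
Qed.

(** * Riemann step functions and existence of the integral *)

Definition node (R : realType) (t : R) (n k : nat) : R := t * k%:R / n.+1%:R.

(** The value on each cell is taken at the left end of the cell, and is 0 on the
    first cell, where the left end may be a singularity of [f]. *)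
Definition step_approx (R : realType) (V : completeNormedModType R) (t : R)
    (f : R -> V) (n : nat) : R -> V :=
  fun x => \sum_(k < n)
    \1_(`[node t n k.+1, node t n k.+2[%classic : set R) x *: f (node t n k.+1).

Definition riemann_sum (R : realType) (V : completeNormedModType R) (t : R)
    (f : R -> V) (n : nat) : V :=
  \sum_(k < n) (t / n.+1%:R) *: f (node t n k.+1).

(** Compatibility with dilations, which the change of variables in [duhamel_scale]
    rests on. *)
Lemma riemann_sum_scale (R : realType) (V : completeNormedModType R) (t : R)
    (f : R -> V) (n : nat) :
  riemann_sum t f n = t *: riemann_sum 1 (fun x => f (t * x)) n.
Proof.
rewrite /riemann_sum scaler_sumr; apply: eq_bigr => k _.
by rewrite scalerA mulrA mulr1 /node mul1r mulrA.
Qed.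

Lemma node_gt0 (R : realType) (t : R) (n k : nat) : 0 < t -> (0 < k)%N ->
  0 < node t n k.
Proof. by move=> t0 k0; rewrite /node !(divr_gt0, mulr_gt0) ?ltr0n. Qed.

Lemma node_lt (R : realType) (t : R) (n k : nat) : 0 < t -> (k < n.+1)%N ->
  node t n k < t.
Proof.
by move=> t0 k0; rewrite /node -mulrA gtr_pMr// ltr_pdivrMr// mul1r ltr_nat.
Qed.

Lemma nodeS (R : realType) (t : R) (n k : nat) :
  node t n k.+1 = node t n k + t / n.+1%:R.
Proof. by rewrite /node -natr1 mulrDr mulr1 mulrDl. Qed.

Lemma simple_function_scaled_indic (R : realType) (V : completeNormedModType R)
    (A : set R) (v : V) : measurable (A : set (measurableTypeR R)) ->
  simple_function (fun x : R => \1_A x *: v) /\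
  forall a b, simple_integral a b (fun x : R => \1_A x *: v) =
    fine (mu (`]a, b[ `&` A)) *: v.
Proof.
move=> mA; pose h (x : R) : bool := x \in A.
have hD x : h x \in [:: true; false] by case: (h x).
have hT : h @^-1` [set true] = A.
  by apply/seteqP; split=> x; rewrite /= /h; [move=> /set_mem|move=> /mem_set].
have mh w : measurable (h @^-1` [set w] : set (measurableTypeR R)).
  case: w; first by rewrite hT.
  rewrite (_ : _ @^-1` _ = ~` A); first exact: measurableC.
  by apply/seteqP; split=> x; rewrite /= /h; [move=> /negP/negP; rewrite
      notin_setE|move=> ?; exact: memNset].
have E : (fun x : R => \1_A x *: v) = (fun c : bool => c%:R *: v) \o h.
  by apply/funext => x; rewrite /= indicE.
split; first by rewrite E; exact: (simple_function_factor _ hD mh).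
move=> a b; rewrite E (@simple_integral_factor _ _ _ a b h _ [:: true; false])//.
by rewrite big_cons big_seq1 /= scale0r scaler0 addr0 scale1r hT.
Qed.

Lemma simple_function_sum (R : realType) (V : completeNormedModType R)
    (n : nat) (s : nat -> R -> V) : (forall k, simple_function (s k)) ->
  simple_function (fun x => \sum_(k < n) s k x) /\
  forall a b, simple_integral a b (fun x => \sum_(k < n) s k x) =
    \sum_(k < n) simple_integral a b (s k).
Proof.
move=> ss; elim: n => [|n [IHs IHI]].
  have [s0 I0] := @simple_function_scaled_indic R V set0 0 (@measurable0 _ _).
  have E : (fun x : R => \sum_(k < 0) s k x) = (fun x : R => \1_set0 x *: 0).
    by apply/funext => x; rewrite big_ord0 scaler0.
  rewrite E; split => // a b.
  by rewrite I0 setI0 measure0 scaler0 big_ord0.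
have E : (fun x => \sum_(k < n.+1) s k x) =
    (fun x => 1 *: (\sum_(k < n) s k x) + s n x).
  by apply/funext => x; rewrite big_ord_recr/= scale1r.
rewrite E; split; first exact: simple_function_linear.
by move=> a b; rewrite simple_integral_linear// scale1r IHI big_ord_recr.
Qed.

Lemma simple_step_approx (R : realType) (V : completeNormedModType R) (t : R)
    (f : R -> V) (n : nat) : simple_function (step_approx t f n).
Proof.
pose s (k : nat) (x : R) :=
  \1_(`[node t n k.+1, node t n k.+2[%classic : set R) x *: f (node t n k.+1).
have [] // := @simple_function_sum _ _ n s.
by move=> k; apply: (@simple_function_scaled_indic _ _ _ _ _).1; exact: measurable_itv.
Qed.

Lemma simple_integral_step_approx (R : realType) (V : completeNormedModType R)
    (t : R) (f : R -> V) (n : nat) : 0 < t ->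
  simple_integral 0 t (step_approx t f n) = riemann_sum t f n.
Proof.
move=> t0.
pose s (k : nat) (x : R) :=
  \1_(`[node t n k.+1, node t n k.+2[%classic : set R) x *: f (node t n k.+1).
have mI k : measurable (`[node t n k.+1, node t n k.+2[%classic : set
    (measurableTypeR R)).
  exact: measurable_itv.
have ss k : simple_function (s k) by have [] := simple_function_scaled_indic (f
    (node t n k.+1)) (mI k).
have [_ ->] := @simple_function_sum _ _ n s ss.
apply: eq_bigr => k _.
have [_ ->] := simple_function_scaled_indic (f (node t n k.+1)) (mI k).
congr (_ *: _).
have tn0 : 0 < t / n.+1%:R by rewrite divr_gt0.
rewrite setIidr; last first.
  move=> x; rewrite /= !in_itv/= => /andP[x1 x2].
  rewrite (lt_le_trans _ x1) ?node_gt0//=; apply: (lt_le_trans x2).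
  by rewrite /node -mulrA ger_pMr// ler_pdivrMr// mul1r ler_nat ltnS ltn_ord.
rewrite lebesgue_measure_itv/= lte_fin (nodeS t n k.+1) ltrDl tn0.
by rewrite -EFinD/= addrAC subrr add0r.
Qed.

(** The bound [x <= 2 * r] holds because the first cell is left out; it
    transfers a domination by a negative power at [r] to one at [x]. *)
Lemma step_approx_value (R : realType) (V : completeNormedModType R) (t : R)
    (f : R -> V) (n : nat) (x : R) : 0 < x < t ->
  (x < t / n.+1%:R /\ step_approx t f n x = 0) \/
  exists r, [/\ 0 < r <= x, x < r + t / n.+1%:R, x <= 2 * r &
    step_approx t f n x = f r].
Proof.
move=> /andP[x0 xt]; have t0 : 0 < t by apply: lt_trans xt.
have N0 : 0 < n.+1%:R :> R by [].
(* x lies in the cell whose index is the integer part of y. *)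
pose y := x * n.+1%:R / t.
have y0 : 0 <= y by rewrite ltW// !(divr_gt0, mulr_gt0).
have cellE k : (x \in `[node t n k, node t n k.+1[) = (Num.truncn y == k).
  rewrite truncn_eq// in_itv/= /y /node ler_pdivlMr// ltr_pdivrMr//.
  by rewrite ler_pdivrMr// ltr_pdivlMr// ![t * _]mulrC.
have sE : step_approx t f n x =
    \sum_(k < n | Num.truncn y == k.+1) f (node t n k.+1).
  rewrite big_mkcond; apply: eq_bigr => k _.
  rewrite indicE mem_setE cellE.
  by case: (Num.truncn y == k.+1); rewrite ?scale1r ?scale0r.
have yn : (Num.truncn y < n.+1)%N.
  have /andP[+ _] := truncn_itv y0.
  rewrite -(ltr_nat R) => /le_lt_trans; apply.
  by rewrite /y ltr_pdivrMr// mulrC ltr_pM2l.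
have [ty0|ty0] := posnP (Num.truncn y).
  left; split.
    have := cellE 0%N; rewrite ty0 eqxx in_itv/= => /andP[_].
    by rewrite nodeS /node mulr0 mul0r add0r.
  by rewrite sE big_pred0// => k; rewrite ty0.
right; exists (node t n (Num.truncn y)).
have := cellE (Num.truncn y); rewrite eqxx in_itv/= => /andP[c1 c2].
rewrite node_gt0//=; split => //.
- by rewrite -nodeS.
- apply: (le_trans (ltW c2)).
  rewrite nodeS mulr2n mulrDl mul1r lerD2l /node mulrAC ler_peMr//.
    by rewrite divr_ge0// ltW.
  by rewrite ler1n.
case: (Num.truncn y) ty0 yn sE => // m _ mn ->.
by rewrite (big_pred1 (Ordinal (mn : (m < n)%N))).
Qed.

Lemma step_approx_cvg (R : realType) (V : completeNormedModType R) (t : R)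
    (f : R -> V) (x : R) : 0 < x < t -> {for x, continuous f} ->
  step_approx t f n x @[n --> \oo] --> f x.
Proof.
move=> x0t cf; have /andP[x0 xt] := x0t; have t0 := lt_trans x0 xt.
apply/cvgrPdist_lt => e e0.
have /cvgrPdist_lt/(_ _ e0)/nbhs_ballP[de /= de0 Hde] := cf.
pose m := Num.min de x.
have m0 : 0 < m by rewrite lt_min de0.
have [N _ HN] := near_infty_natSinv_lt (PosNum (divr_gt0 m0 t0)).
exists N => // n /= /HN /=; rewrite ltr_pdivlMr// mulrC => tn.
have [[xn _]|[r [/andP[r0 rx] xr _ ->]]] := step_approx_value f n x0t.
  by exfalso; move: (lt_trans xn tn); rewrite lt_min ltxx andbF.
apply: Hde; rewrite /ball/= ger0_norm ?subr_ge0// ltrBlDl.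
by apply: (lt_trans xr); rewrite ltrD2l; move: tn; rewrite lt_min => /andP[].
Qed.

(** Convergence in mean makes the simple integrals a Cauchy sequence, so that
    completeness provides the integral. *)
Lemma is_bochner_integral_of_L1 (R : realType) (V : completeNormedModType R)
    (a b : R) (f : R -> V) (s : nat -> R -> V) :
  (forall n, simple_function (s n)) ->
  (forall x, a < x < b -> s n x @[n --> \oo] --> f x) ->
  (\int[mu]_(x in `]a, b[) (`|f x - s n x|)%:E)%E @[n --> \oo] --> 0%E ->
  exists2 I, is_bochner_integral a b f I &
    simple_integral a b (s n) @[n --> \oo] --> I.
Proof.
move=> ss sf L.
have mI : measurable (`]a, b[%classic : set (measurableTypeR R)).
  exact: measurable_itv.
have lf : simple_limit `]a, b[ f.
  by exists s => // x; rewrite /= in_itv/=; exact: sf.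
have mfs n : measurable_fun (`]a, b[ : set (measurableTypeR R)) (fun x => (`|f x -
    s n x|)%:E).
  apply/measurable_EFinP; apply: simple_limit_measurable => //.
  by apply: simple_limitB => //; exact: simple_limit_simple.
have D n m : (`|simple_integral a b (s n) - simple_integral a b (s m)|%:E <=
    \int[mu]_(x in `]a, b[) (`|f x - s n x|)%:E +
    \int[mu]_(x in `]a, b[) (`|f x - s m x|)%:E)%E.
  have -> : simple_integral a b (s n) - simple_integral a b (s m) =
      simple_integral a b (fun x => (-1) *: s m x + s n x).
    by rewrite simple_integral_linear// scaleN1r addrC.
  apply: le_trans (norm_simple_integral _ _ (simple_function_linear _ _ _)) _ => //.
  rewrite -ge0_integralD//; apply: ge0_le_integral => //.
  - apply/measurable_EFinP; apply: (@measurable_funS _ _ _ _ setT) => //.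
    by apply: (simple_function_measurable Num.norm); exact: simple_function_linear.
  - exact: emeasurable_funD.
  move=> x _; rewrite -EFinD lee_fin scaleN1r.
  rewrite (_ : - s m x + s n x = (f x - s m x) - (f x - s n x)); last first.
    by rewrite opprB [s n x - f x]addrC addrACA subrr add0r.
  by rewrite [X in _ <= X]addrC; apply: ler_normB.
have /cauchy_cvgP Sc : cauchy (simple_integral a b (s n) @[n --> \oo]).
  apply/cauchy_ballP => e e0.
  have e2 : 0 < e / 2 by rewrite divr_gt0.
  have : \forall n \near \oo, (\int[mu]_(x in `]a, b[) (`|f x - s n x|)%:E < (e /
      2)%:E)%E.
    have [Lf Lr] := (fine_cvgP _ _).1 L.
    apply: filterS2 Lf (cvgr_lt _ Lr _ e2) => n fin lt_n.
    by rewrite -(fineK fin) lte_fin.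
  move=> [N _ HN]; exists ((simple_integral a b \o s) @` [set n | (N <= n)%N],
      (simple_integral a b \o s) @` [set n | (N <= n)%N]).
    by split; exists N => // n Nn; exists n.
  move=> [_ _] [[n Nn <-] [m Nm <-]] /=; rewrite -ball_normE/=.
  rewrite -lte_fin; apply: (le_lt_trans (D n m)).
  by rewrite (splitr e) EFinD; apply: lteD; exact: HN.
move: Sc => /cvg_ex[I SI]; exists I => //; split; last by exists s.
exists s => //; apply: aeW => x; rewrite /= in_itv/=; exact: sf.
Qed.

Lemma integrable_beta_weight (R : realType) (d e k t : R) :
  0 <= d < 1 -> 0 <= e < 1 -> 0 <= k -> 0 < t ->
  mu.-integrable (`]0, t[ : set (measurableTypeR R))
    (fun x => (k * ((t - x) `^ (- d) * x `^ (- e)))%:E).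
Proof.
move=> d01 e01 k0 t0; have [B B0 HB] := integral_beta_weight_le d01 e01.
have mI : measurable (`]0, t[%classic : set (measurableTypeR R)).
  exact: measurable_itv.
apply/integrableP; split.
  by apply/measurable_EFinP; apply: measurable_funM => //; exact:
      measurable_beta_weight.
have -> : (\int[mu]_(x in `]0%R, t[) `|(k * ((t - x) `^ (- d) * x `^ (- e)))%:E| =
    \int[mu]_(x in `]0%R, t[) (k%:E * ((t - x) `^ (- d) * x `^ (- e))%:E))%E.
  by apply: eq_integral => x _; rewrite -EFinM gee0_abs// lee_fin !mulr_ge0 ?powR_ge0.
rewrite ge0_integralZl_EFin//; last 2 first.
- by move=> x _; rewrite lee_fin mulr_ge0 ?powR_ge0.
- by apply/measurable_EFinP; exact: measurable_beta_weight.
apply: (@le_lt_trans _ _ (k%:E * (B * t `^ (1 - d) * t `^ (- e))%:E)%E).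
  by apply: lee_wpmul2l; [rewrite lee_fin|exact: HB].
by rewrite -EFinM ltry.
Qed.

(** The step functions are dominated, up to the factor 2 ^ e, by the same weight
    as [f]: moving to the left end of a cell lowers (t - x) ^ (- d), and raises
    x ^ (- e) by at most 2 ^ e. Dominated convergence then gives convergence in
    mean. *)
Lemma bochner_integral_exists (R : realType) (V : completeNormedModType R)
    (d e c t : R) (f : R -> V) :
  0 <= d < 1 -> 0 <= e < 1 -> 0 < t ->
  (forall x, 0 < x < t -> {for x, continuous f}) ->
  (forall x, 0 < x < t -> `|f x| <= c * ((t - x) `^ (- d) * x `^ (- e))) ->
  exists2 I, is_bochner_integral 0 t f I &
    riemann_sum t f n @[n --> \oo] --> I.
Proof.
move=> d01 e01 t0 cf fle.
have /andP[d0 d1] := d01; have /andP[e0 e1] := e01.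
have mI : measurable (`]0, t[%classic : set (measurableTypeR R)).
  exact: measurable_itv.
pose w x := (t - x) `^ (- d) * x `^ (- e).
have w0 x : 0 <= w x by rewrite mulr_ge0 ?powR_ge0.
have wt0 x : 0 < x < t -> 0 < w x.
  by move=> /andP[x0 xt]; rewrite mulr_gt0 ?powR_gt0 ?subr_gt0.
(* The weight is positive at t / 2, so the bound there forces 0 <= c. *)
have c0 : 0 <= c.
  have t2 : 0 < t / 2 < t by rewrite divr_gt0//= ltr_pdivrMr// mulr_natr mulr2n ltrDl.
  by have := le_trans (normr_ge0 _) (fle _ t2); rewrite (pmulr_lge0 _ (wt0 _ t2)).
have sle n x : 0 < x < t -> `|step_approx t f n x| <= c * 2 `^ e * w x.
  move=> x0t; have [[_ ->]|[r [/andP[r0 rx] xr x2r ->]]] := step_approx_value f n x0t.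
    by rewrite normr0 !mulr_ge0// powR_ge0.
  have /andP[x0 xt] := x0t; have rt : r < t by apply: le_lt_trans xt.
  apply: le_trans (fle r _) _; first by rewrite r0.
  rewrite -mulrA ler_wpM2l// /w mulrCA; apply: ler_pM; rewrite ?powR_ge0//.
    rewrite !powRN lef_pV2 ?posrE ?powR_gt0 ?subr_gt0//.
    by rewrite ge0_ler_powR ?nnegrE ?lerD2l ?lerN2// subr_ge0 ltW.
  rewrite !powRN -ler_pdivrMl ?powR_gt0// -invfM lef_pV2 ?posrE ?mulr_gt0 ?powR_gt0//.
  rewrite -(powRM _ (ler0n _ _) (ltW r0)) ge0_ler_powR// nnegrE.
    exact: ltW.
  by rewrite mulr_ge0// ltW.
have sf x : 0 < x < t -> step_approx t f n x @[n --> \oo] --> f x.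
  by move=> x0t; exact: (step_approx_cvg x0t (cf x x0t)).
have [||I bI SI] := @is_bochner_integral_of_L1 R V 0 t f (step_approx t f) _ sf.
- by move=> n; exact: simple_step_approx.
- have lf : simple_limit `]0, t[ f.
    exists (step_approx t f); first by move=> n; exact: simple_step_approx.
    by move=> x; rewrite /= in_itv/=; exact: sf.
  have [|||||_ _ L] := @dominated_convergence _ _ R mu `]0, t[%classic mI
    (fun n x => (`|f x - step_approx t f n x|)%:E) (cst 0%E)
    (fun x => ((c + c * 2 `^ e) * w x)%:E).
  + move=> n; apply/measurable_EFinP; apply: simple_limit_measurable => //.
    by apply: simple_limitB => //; apply: simple_limit_simple; exact:
        simple_step_approx.
  + exact: measurable_cst.
  + apply: aeW => x; rewrite /= in_itv/= => x0t; apply: cvg_EFin; first exact: nearW.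
    rewrite -(normr0 V) -(subrr (f x)); apply: cvg_norm; apply: cvgB; first exact:
        cvg_cst.
    exact: sf.
  + by apply: integrable_beta_weight => //; rewrite addr_ge0// mulr_ge0// powR_ge0.
  + apply: aeW => x n; rewrite /= in_itv/= => x0t; rewrite lee_fin normr_id mulrDl.
    by apply: le_trans (ler_normB _ _) _; apply: lerD; [exact: fle|exact: sle].
  by move: L; rewrite integral0.
exists I => //.
by under eq_cvg do rewrite -simple_integral_step_approx//.
Qed.

(** * Kernels with a singularity at time zero *)

(** The bound is local in time: the constant may grow with [T]. *)
Record singular_kernel (R : realType) (V : completeNormedModType R) (d : R)
    (A : R -> V -> V) : Prop := SingularKernel {
  kernel_linear : forall t, 0 < t -> linear (A t) ;
  kernel_continuous : forall x t, 0 < t -> {for t, continuous (A ^~ x)} ;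
  kernel_bound : forall T, 0 < T -> exists2 C, 0 <= C &
    forall t x, 0 < t <= T -> `|A t x| <= C * t `^ (- d) * `|x|
}.

Definition weighted_bound (R : realType) (V : completeNormedModType R) (e : R)
    (u : R -> V) : Prop :=
  forall T, 0 < T -> exists2 c, 0 <= c &
    forall t, 0 < t <= T -> `|u t| <= c * t `^ (- e).

Definition continuous_pos (R : realType) (V : completeNormedModType R)
    (u : R -> V) : Prop := forall t, 0 < t -> {for t, continuous u}.

(** As a limit of Riemann sums, the integral can be compared over intervals of
    different lengths. *)
Definition duhamel (R : realType) (V : completeNormedModType R)
    (A : R -> V -> V) (u : R -> V) (t : R) : V :=
  lim (riemann_sum t (fun x => A (t - x) (u x)) n @[n --> \oo]).

(** Strong continuity in time and local boundedness give joint continuity: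
    A p q - A p0 q0 = A p (q - q0) + (A p - A p0) q0. *)
Lemma kernel_cvg (R : realType) (V : completeNormedModType R) (d : R)
    (A : R -> V -> V) (X : Type) (F : set_system X) {FF : Filter F}
    (p : X -> R) (q : X -> V) (p0 : R) (q0 : V) :
  0 <= d -> singular_kernel d A -> 0 < p0 ->
  p x @[x --> F] --> p0 -> q x @[x --> F] --> q0 ->
  A (p x) (q x) @[x --> F] --> A p0 q0.
Proof.
move=> d0 [Alin Acont Abnd] p00 pF qF.
have [C C0 HC] := Abnd (p0 + 1) (addr_gt0 p00 ltr01).
have A1 : A (p x) q0 @[x --> F] --> A p0 q0.
  exact: (cvg_comp _ _ pF (Acont q0 p0 p00)).
apply/cvgrPdist_le => e e0.
have e2 : 0 < e / 2 by rewrite divr_gt0.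
(* A bound for the norm of A p as long as p0 / 2 < p <= p0 + 1. *)
pose K := C * (p0 / 2) `^ (- d) + 1.
have K0 : 0 < K by rewrite ltr_wpDl// mulr_ge0// powR_ge0.
have eK : 0 < e / 2 / K by rewrite divr_gt0.
near=> x.
have px1 : p0 / 2 < p x.
  by near: x; apply: (cvgr_gt _ pF); rewrite ltr_pdivrMr// mulr_natr mulr2n ltrDl.
have px2 : p x <= p0 + 1.
  by near: x; apply: (cvgr_le _ pF); rewrite ltrDl.
have px0 : 0 < p x by apply: lt_trans px1; rewrite divr_gt0.
have -> : A p0 q0 - A (p x) (q x) =
    (A p0 q0 - A (p x) q0) + A (p x) (q0 - q x).
  have -> : q0 - q x = (-1) *: q x + q0 by rewrite scaleN1r addrC.
  by rewrite Alin// scaleN1r [- _ + A _ _]addrC addrA subrK.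
rewrite (splitr e); apply: le_trans (ler_normD _ _) _; apply: lerD.
  by near: x; by move/cvgrPdist_le : A1; apply.
apply: le_trans (HC _ _ _) _; first by rewrite px0.
apply: (@le_trans _ _ (K * `|q0 - q x|)).
  rewrite ler_wpM2r// ler_wpDr// ler_wpM2l// gt0_ler_powRN//.
    by rewrite divr_gt0.
  exact: ltW.
rewrite mulrC -ler_pdivlMr//.
by near: x; by move/cvgrPdist_le : qF; apply.
Unshelve. all: by end_near. Qed.

Lemma duhamel_integral (R : realType) (V : completeNormedModType R) (d e : R)
    (A : R -> V -> V) (u : R -> V) (t : R) :
  0 <= d < 1 -> 0 <= e < 1 -> singular_kernel d A ->
  continuous_pos u -> weighted_bound e u -> 0 < t ->
  is_bochner_integral 0 t (fun x => A (t - x) (u x)) (duhamel A u t).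
Proof.
move=> d01 e01 kA cu bu t0.
have [C C0 HC] := kernel_bound kA t0; have [c c0 Hc] := bu t t0.
have [||I bI RI] := @bochner_integral_exists R V d e (C * c) t
  (fun x => A (t - x) (u x)) d01 e01 t0.
- move=> x /andP[x0 xt]; apply: (kernel_cvg _ kA); first by case/andP: d01.
  + by rewrite subr_gt0.
  + by apply: cvgB; [exact: cvg_cst|exact: cvg_id].
  + exact: cu.
- move=> x /andP[x0 xt].
  have tx : 0 < t - x <= t by rewrite subr_gt0 xt gerBl ltW.
  apply: le_trans (HC _ _ tx) _.
  rewrite [X in _ <= X](_ : _ = (C * (t - x) `^ (- d)) * (c * x `^ (- e))); last by
      ring.
  by rewrite ler_wpM2l ?mulr_ge0 ?powR_ge0// Hc// x0 ltW.
by rewrite (_ : duhamel A u t = I)//; apply/cvg_lim.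
Qed.

(** The substitution x = t * y, which moves the integral to the interval (0, 1),
    independent of [t]. *)
Lemma duhamel_scale (R : realType) (V : completeNormedModType R) (d e : R)
    (A : R -> V -> V) (u : R -> V) :
  0 <= d < 1 -> 0 <= e < 1 -> singular_kernel d A ->
  continuous_pos u -> weighted_bound e u ->
  exists2 G : R -> V, (forall t, 0 < t ->
     is_bochner_integral 0 1 (fun x => A (t - t * x) (u (t * x))) (G t)) &
    (forall t, 0 < t -> duhamel A u t = t *: G t).
Proof.
move=> d01 e01 kA cu bu.
pose G t := lim (riemann_sum 1 (fun x => A (t - t * x) (u (t * x))) n @[n --> \oo]).
have key t : 0 < t -> is_bochner_integral 0 1 (fun x => A (t - t * x) (u (t * x)))
    (G t) /\
    riemann_sum 1 (fun x => A (t - t * x) (u (t * x))) n @[n --> \oo] --> G t.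
  move=> t0; have [C C0 HC] := kernel_bound kA t0; have [c c0 Hc] := bu t t0.
  have [||I bI RI] := @bochner_integral_exists R V d e (C * c * (t `^ (- d) * t `^
      (- e))) 1
    (fun x => A (t - t * x) (u (t * x))) d01 e01 ltr01.
  - move=> x /andP[x0 x1]; apply: (kernel_cvg _ kA); first by case/andP: d01.
    + by rewrite subr_gt0 gtr_pMr.
    + by apply: cvgB; [exact: cvg_cst|apply: cvgMr; exact: cvg_id].
    + apply: (@cvg_comp _ _ _ (fun x => t * x) u _ (nbhs (t * x))).
        by apply: cvgMr; exact: cvg_id.
      by apply: cu; rewrite mulr_gt0.
  - move=> x /andP[x0 x1].
    have tx : 0 < t - t * x <= t by rewrite subr_gt0 gtr_pMr// x1 gerBl mulr_ge0// ltW.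
    have tx' : 0 < t * x <= t by rewrite mulr_gt0//= ger_pMr// ltW.
    apply: le_trans (HC _ _ tx) _.
    rewrite [X in _ <= X](_ : _ = (C * (t - t * x) `^ (- d)) * (c * (t * x) `^ (- e))).
      by rewrite ler_wpM2l ?mulr_ge0 ?powR_ge0// Hc.
    rewrite (_ : t - t * x = t * (1 - x)); last by ring.
    rewrite !powRM ?subr_ge0 ?(ltW t0) ?(ltW x0) ?(ltW x1)//.
    ring.
  by rewrite (_ : G t = I)//; apply/cvg_lim.
exists G => t t0; first by case: (key t t0).
apply/cvg_lim => //.
under eq_cvg do rewrite riemann_sum_scale.
by apply: cvgZr; case: (key t t0).
Qed.

(** By dominated convergence on (0, 1): for t near t0 the integrands share the
    dominating function K * (1 - x) ^ (- d) * x ^ (- e). *)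
Lemma duhamel_continuous (R : realType) (V : completeNormedModType R) (d e : R)
    (A : R -> V -> V) (u : R -> V) :
  0 <= d < 1 -> 0 <= e < 1 -> singular_kernel d A ->
  continuous_pos u -> weighted_bound e u -> continuous_pos (duhamel A u).
Proof.
move=> d01 e01 kA cu bu t0 t00.
have /andP[d0 d1] := d01; have /andP[e0 e1] := e01.
have [G bG dG] := duhamel_scale d01 e01 kA cu bu.
pose g t x := A (t - t * x) (u (t * x)).
have gt x t : 0 < t -> 0 < x < 1 -> {for t, continuous (g ^~ x)}.
  move=> t0' /andP[x0 x1]; apply: (kernel_cvg d0 kA).
  - by rewrite subr_gt0 gtr_pMr.
  - by apply: cvgB; [exact: cvg_id|apply: cvgMl; exact: cvg_id].
  - apply: (@cvg_comp _ _ _ (fun t => t * x) u _ (nbhs (t * x))).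
      by apply: cvgMl; exact: cvg_id.
    by apply: cu; rewrite mulr_gt0.
have gx x t : 0 < t -> 0 < x < 1 -> {for x, continuous (g t)}.
  move=> t0' /andP[x0 x1]; apply: (kernel_cvg d0 kA).
  - by rewrite subr_gt0 gtr_pMr.
  - by apply: cvgB; [exact: cvg_cst|apply: cvgMr; exact: cvg_id].
  - apply: (@cvg_comp _ _ _ (fun x => t * x) u _ (nbhs (t * x))).
      by apply: cvgMr; exact: cvg_id.
    by apply: cu; rewrite mulr_gt0.
have mI : measurable (`]0%R, 1%R[%classic : set (measurableTypeR R)).
  exact: measurable_itv.
pose w (x : R) := (1 - x) `^ (- d) * x `^ (- e).
have t20 : 0 < t0 / 2 by rewrite divr_gt0.
have t2 : t0 < 2 * t0 by rewrite mulr_natl mulr2n ltrDl.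
have [C C0 HC] := kernel_bound kA (lt_trans t00 t2).
have [c c0 Hc] := bu _ (lt_trans t00 t2).
pose K := C * c * ((t0 / 2) `^ (- d) * (t0 / 2) `^ (- e)).
have K0 : 0 <= K by rewrite !mulr_ge0 ?powR_ge0.
have gb t x : t0 / 2 < t < 2 * t0 -> 0 < x < 1 -> `|g t x| <= K * w x.
  move=> /andP[t1 t2'] /andP[x0 x1]; have tp : 0 < t by apply: lt_trans t1.
  have tx : 0 < t - t * x <= 2 * t0.
    rewrite subr_gt0 gtr_pMr// x1/= (le_trans _ (ltW t2'))//.
    by rewrite gerBl mulr_ge0// ltW.
  have tx' : 0 < t * x <= 2 * t0.
    by rewrite mulr_gt0//= (le_trans _ (ltW t2'))// ger_pMr// ltW.
  apply: le_trans (HC _ _ tx) _.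
  apply: (@le_trans _ _ ((C * (t - t * x) `^ (- d)) * (c * (t * x) `^ (- e)))).
    by rewrite ler_wpM2l ?mulr_ge0 ?powR_ge0// Hc.
  rewrite (_ : t - t * x = t * (1 - x)); last by ring.
    rewrite !powRM ?subr_ge0 ?(ltW tp) ?(ltW x0) ?(ltW x1)//.
  rewrite [X in X <= _](_ : _ = (C * c * (t `^ (- d) * t `^ (- e))) * w x); last by
      rewrite /w; ring.
  rewrite ler_wpM2r ?mulr_ge0 ?powR_ge0// ler_wpM2l ?mulr_ge0//.
  by apply: ler_pM; rewrite ?powR_ge0// gt0_ler_powRN// ltW.
have mg t t' : 0 < t -> 0 < t' ->
    measurable_fun (`]0%R, 1%R[ : set (measurableTypeR R)) (fun x => `|g t x - g t'
        x| : R).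
  move=> tp tp'; apply: open_continuous_measurable_fun; first exact: interval_open.
  move=> x; rewrite inE/= in_itv/= => x01.
  by apply: cvg_norm; apply: cvgB; exact: gx.
have tI : t0 / 2 < t0 < 2 * t0.
  by rewrite t2 andbT ltr_pdivrMr// mulr_natr mulr2n ltrDl.
(* F dominates |G t - G t0| and vanishes at t0. *)
pose F t := (\int[mu]_(x in `]0%R, 1%R[) `|g t x - g t0 x|)%R.
have gdb t x : t0 / 2 < t < 2 * t0 -> 0 < x < 1 -> `|g t x - g t0 x| <= (K + K) * w x.
  move=> tt x01; apply: le_trans (ler_normB _ _) _; rewrite mulrDl.
  by apply: lerD; apply: gb.
have intw := @integrable_beta_weight R d e (K + K) 1 d01 e01 (addr_ge0 K0 K0) ltr01.
have Iint t : t0 / 2 < t < 2 * t0 -> mu.-integrable (`]0%R, 1%R[ : set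
    (measurableTypeR R))
    (EFin \o (fun x => `|g t x - g t0 x|)).
  move=> tt; apply: (le_integrable _ _ _ intw) => //.
    by apply/measurable_EFinP; apply: mg => //; apply: lt_trans (andP tt).1.
  move=> x; rewrite /= in_itv/= => x01; rewrite !lee_fin normr_id.
  by apply: le_trans (gdb _ _ tt x01) _; rewrite ler_norm.
have cF : {for t0, continuous F}.
  have := @continuity_under_integral R _ _ mu (fun t x => `|g t x - g t0 x|)
    `]0%R, 1%R[%classic mI (t0 / 2) (2 * t0) _ _ (fun x => (K + K) * w x) intw.
  apply.
  - by move=> t; rewrite /= in_itv/=; exact: Iint.
  - apply: aeW => x; rewrite /= in_itv/= => x01 t; rewrite inE/= in_itv/= =>
        /andP[tt _].
    apply: cvg_norm; apply: cvgB; last exact: cvg_cst.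
    by apply: gt => //; apply: lt_trans tt.
  - move=> t; rewrite /= in_itv/= => tt; apply: aeW => x; rewrite /= in_itv/= => x01.
    by rewrite normr_id; exact: gdb.
  - by rewrite inE/= in_itv.
have F0 : F t0 = 0.
  rewrite /F /Rintegral (eq_integral (cst 0%E)) ?integral0//.
  by move=> x _; rewrite subrr normr0.
have GF t : t0 / 2 < t < 2 * t0 -> `|G t - G t0| <= F t.
  move=> tt; have tp : 0 < t by apply: lt_trans (andP tt).1.
  have B1 := bochner_ae_linear (-1) (is_bochner_integral_ae (bG t0 t00))
      (is_bochner_integral_ae (bG t tp)).
  have := bochner_ae_norm_le B1 (mg t t0 tp t00).
  rewrite scaleN1r [_ + G t]addrC -lee_fin /F /Rintegral fineK.
    apply => x _; rewrite scaleN1r addrC; exact: lexx.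
  by apply: integrable_fin_num => //; exact: Iint.
have cG : {for t0, continuous G}.
  apply/cvgrPdist_le => e' e'0.
  move/cvgrPdist_le : cF => /(_ _ e'0); rewrite F0 => cF.
  near=> t; rewrite distrC; apply: (@le_trans _ _ (F t)).
    apply: GF; apply/andP; split; near: t.
      by apply: lt_nbhsr; case/andP: tI.
    exact: lt_nbhsl.
  apply: le_trans (ler_norm _) _; rewrite -normrN -sub0r; near: t.
  exact: cF.
rewrite /prop_for /continuous_at dG//.
have L : t *: G t @[t --> t0] --> t0 *: G t0.
  exact: (@cvgZ _ _ _ (nbhs t0) _ id G t0 (G t0) (@cvg_id _ _) cG).
apply: (@cvg_trans _ (t *: G t @[t --> t0])); last exact: L.
apply: near_eq_cvg; near=> t; rewrite dG//; near: t; exact: lt_nbhsr.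
Unshelve. all: by end_near. Qed.

(** * The contraction estimate and its consequences *)

Lemma eq_bochner_ae (R : realType) (V : completeNormedModType R) (a b : R)
    (f g : R -> V) (I : V) : (forall x, a < x < b -> f x = g x) ->
  bochner_ae a b f I -> bochner_ae a b g I.
Proof.
move=> fg [E [mE Eab E0 [s0 ss0 sf] [s [ss fs sI]]]].
have fgE x : E x -> f x = g x.
  by move=> /Eab; rewrite /= in_itv/=; exact: fg.
exists E; split => //; first by exists s0 => // x Ex; rewrite -fgE//; exact: sf.
exists s; split => //; apply: cvg_trans fs; apply: near_eq_cvg; apply: nearW => n.
by apply: eq_integral => x /set_mem Ex; rewrite fgE.
Qed.

Lemma bochner_ae_kernel_linear (R : realType) (V : completeNormedModType R) (d : R)
    (A : R -> V -> V) (c t : R) (u v : R -> V) (I I' : V) :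
  singular_kernel d A ->
  bochner_ae 0 t (fun x => A (t - x) (u x)) I ->
  bochner_ae 0 t (fun x => A (t - x) (v x)) I' ->
  bochner_ae 0 t (fun x => A (t - x) (c *: u x + v x)) (c *: I + I').
Proof.
move=> kA bu bv; apply: eq_bochner_ae (bochner_ae_linear c bu bv) => x /andP[_ xt].
by rewrite (kernel_linear kA)// subr_gt0.
Qed.

(** The key estimate: in the supremum norm weighted by
    t ^ (- e) * expR (lam * t), the Volterra operator is a contraction of ratio
    1 / 2 on (0, T]. *)
Lemma kernel_contraction (R : realType) (V : completeNormedModType R)
    (d e T : R) (n : nat) (A : 'I_n -> R -> V -> V) :
  0 <= d < 1 -> 0 <= e < 1 -> 0 < T -> (forall i, singular_kernel d (A i)) ->
  exists2 lam, 0 <= lam & forall (u : R -> V) (t b : R) (I : 'I_n -> V),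
    0 < t <= T -> 0 <= b ->
    (forall x, 0 < x <= T -> `|u x| <= b * (x `^ (- e) * expR (lam * x))) ->
    (forall i, bochner_ae 0 t (fun x => A i (t - x) (u x)) (I i)) ->
    `|\sum_(i < n) I i| <= b / 2 * (t `^ (- e) * expR (lam * t)).
Proof.
move=> d01 e01 T0 kA.
have /choice[C HC] i : exists C, 0 <= C /\
    forall t x, 0 < t <= T -> `|A i t x| <= C * t `^ (- d) * `|x|.
  by have [C C0 HC] := kernel_bound (kA i) T0; exists C.
pose S := \sum_(i < n) C i.
have S0 : 0 <= S by apply: sumr_ge0 => i _; case: (HC i).
have eta0 : 0 < (2 * (S + 1))^-1 by rewrite invr_gt0 mulr_gt0// ltr_wpDl.
have [lam lam0 Hlam] := exp_weighted_kernel_le d01 e01 T0 eta0.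
exists lam => // u t b I t0T b0 ub bI.
have /andP[t0 tT] := t0T.
pose W x := x `^ (- e) * expR (lam * x).
have W0 x : 0 <= W x by rewrite mulr_ge0 ?powR_ge0 ?expR_ge0.
have key i : `|I i| <= C i * b * ((2 * (S + 1))^-1 * W t).
  have [Ci0 HCi] := HC i.
  have mphi : measurable_fun (`]0, t[ : set (measurableTypeR R))
      (fun x => (t - x) `^ (- d) * W x : R).
    apply: (@measurable_funS _ _ _ _ setT) => //.
    apply: measurable_funM.
      by apply: (measurableT_comp (measurable_powR (- d))); exact: measurable_funB.
    apply: measurable_funM => //.
    by apply: (measurableT_comp (@measurable_expR R)); exact: measurable_funM.
  have := @bochner_ae_norm_le R V 0 t _ _ (fun x => (C i * b) * ((t - x) `^ (- d) *
      W x)) (bI i).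
  have Cb0 : 0 <= C i * b by rewrite mulr_ge0.
  move=> /(_ (measurable_funM (measurable_cst _) mphi)) H.
  rewrite -lee_fin; apply: le_trans (H _) _.
    move=> x /andP[x0 xt].
    have tx : 0 < t - x <= T by rewrite subr_gt0 xt (le_trans _ tT)// gerBl ltW.
    apply: le_trans (HCi _ _ tx) _.
    rewrite [X in _ <= X](_ : _ = (C i * (t - x) `^ (- d)) * (b * W x)); last by ring.
    by rewrite ler_wpM2l ?mulr_ge0 ?powR_ge0// ub// x0 (le_trans (ltW xt)).
  under eq_integral do rewrite EFinM.
  rewrite ge0_integralZl_EFin//; last 2 first.
  - by move=> x _; rewrite lee_fin mulr_ge0 ?powR_ge0.
  - exact/measurable_EFinP.
  rewrite [X in (_ <= X)%E]EFinM; apply: lee_wpmul2l; first by rewrite lee_fin.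
  exact: Hlam.
apply: le_trans (ler_norm_sum _ _ _) _.
apply: (@le_trans _ _ (\sum_(i < n) C i * b * ((2 * (S + 1))^-1 * W t))).
  by apply: ler_sum => i _; exact: key.
rewrite -mulr_suml -mulr_suml -/S.
rewrite [X in X <= _](_ : _ = (b / 2 * W t) * (S / (S + 1))); last first.
  by field; lra.
rewrite -[X in _ <= X]mulr1 ler_wpM2l ?mulr_ge0 ?divr_ge0 ?powR_ge0 ?expR_ge0//.
by rewrite ler_pdivrMr; lra.
Qed.

Definition volterra_solution (R : realType) (V : completeNormedModType R)
    (n : nat) (A : 'I_n -> R -> V -> V) (h u : R -> V) : Prop :=
  forall t, 0 < t -> exists I : 'I_n -> V,
    (forall i, bochner_ae 0 t (fun x => A i (t - x) (u x)) (I i)) /\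
    u t = h t + \sum_(i < n) I i.

Lemma volterra_solution_linear (R : realType) (V : completeNormedModType R) (d : R)
    (n : nat) (A : 'I_n -> R -> V -> V) (c : R) (h k u v : R -> V) :
  (forall i, singular_kernel d (A i)) ->
  volterra_solution A h u -> volterra_solution A k v ->
  volterra_solution A (fun t => c *: h t + k t) (fun t => c *: u t + v t).
Proof.
move=> kA su sv t t0; have [I [bI uE]] := su t t0; have [I' [bI' vE]] := sv t t0.
exists (fun i => c *: I i + I' i); split.
  by move=> i; exact: bochner_ae_kernel_linear (kA i) (bI i) (bI' i).
by rewrite uE vE scalerDr addrACA big_split/= scaler_sumr.
Qed.

Lemma weighted_bound_linear (R : realType) (V : completeNormedModType R) (c e : R)
    (u v : R -> V) : weighted_bound e u -> weighted_bound e v ->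
  weighted_bound e (fun t => c *: u t + v t).
Proof.
move=> bu bv T T0; have [a a0 Ha] := bu T T0; have [b b0 Hb] := bv T T0.
exists (`|c| * a + b) => [|t tT]; first by rewrite addr_ge0 ?mulr_ge0.
apply: le_trans (ler_normD _ _) _; rewrite mulrDl normrZ -mulrA.
by apply: lerD; [rewrite ler_wpM2l// Ha|exact: Hb].
Qed.

(** If |u| <= b W then |u| <= (m + b / 2) W; iterating this from any b leads to
    |u| <= 2 m W. *)
Lemma volterra_apriori (R : realType) (V : completeNormedModType R)
    (d e T : R) (n : nat) (A : 'I_n -> R -> V -> V) :
  0 <= d < 1 -> 0 <= e < 1 -> 0 < T -> (forall i, singular_kernel d (A i)) ->
  exists2 K, 0 <= K & forall (h u : R -> V) (m : R), 0 <= m ->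
    volterra_solution A h u -> weighted_bound e u ->
    (forall t, 0 < t <= T -> `|h t| <= m * t `^ (- e)) ->
    forall t, 0 < t <= T -> `|u t| <= K * m * t `^ (- e).
Proof.
move=> d01 e01 T0 kA.
have [lam lam0 Hlam] := kernel_contraction d01 e01 T0 kA.
exists (2 * expR (lam * T)); first by rewrite mulr_ge0 ?expR_ge0.
move=> h u m m0 su bu hm.
have [c c0 uc] := bu T T0.
pose W x := x `^ (- e) * expR (lam * x).
have W0 x : 0 <= W x by rewrite mulr_ge0 ?powR_ge0 ?expR_ge0.
have PW x : 0 < x <= T -> x `^ (- e) <= W x.
  move=> /andP[x0 xT]; rewrite ler_peMr ?powR_ge0//.
  by rewrite -expR0 ler_expR mulr_ge0// ltW.
(* The excess over 2 * m need not decay geometrically: c / k.+1 also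
   reproduces itself, since c / k.+1 / 2 <= c / k.+2, and tends to 0. *)
have claim (k : nat) t : 0 < t <= T -> `|u t| <= (2 * m + c / k.+1%:R) * W t.
  elim: k t => [|k IH] t tT.
    apply: le_trans (uc _ tT) _; apply: ler_pM; rewrite ?powR_ge0//; last exact: PW.
    by rewrite invr1 mulr1 lerDr mulr_ge0.
  have /andP[t0 _] := tT.
  have [I [bI ->]] := su t t0.
  have b0 : 0 <= 2 * m + c / k.+1%:R by rewrite addr_ge0 ?mulr_ge0 ?invr_ge0.
  have := Hlam u t _ I tT b0 IH bI; rewrite -/(W t) => HI.
  apply: le_trans (ler_normD _ _) _.
  apply: (@le_trans _ _ (m * W t + (2 * m + c / k.+1%:R) / 2 * W t)).
    apply: lerD HI; apply: le_trans (hm _ tT) _; rewrite ler_wpM2l//; exact: PW.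
  rewrite -mulrDl ler_wpM2r//.
  have : c / k.+1%:R / 2 <= c / k.+2%:R.
    rewrite -mulrA ler_wpM2l// -invfM lef_pV2 ?posrE ?mulr_gt0//.
    by rewrite -natrM ler_nat muln2 -addnn addSnnS leq_addl.
  by move: (c / k.+1%:R) (c / k.+2%:R) => x y; lra.
move=> t tT; have /andP[t0 tT'] := tT.
have le2 : `|u t| <= 2 * m * W t.
  apply/ler_addgt0Pr => e' e'0.
  have [q q0 qE] : exists2 q, 0 < q & c * W t * q <= e'.
    have z0 : 0 <= c * W t by rewrite mulr_ge0.
    exists (e' / (c * W t + 1)); first by rewrite divr_gt0// ltr_wpDl.
    by rewrite mulrA ler_pdivrMr ?ltr_wpDl//; move: (c * W t) z0 => z z0; nra.
  have [k _ /(_ k (leqnn k)) /= kq] := near_infty_natSinv_lt (PosNum q0).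
  apply: le_trans (claim k t tT) _; rewrite mulrDl lerD2l.
  rewrite mulrAC; apply: le_trans qE.
  exact: (ler_wpM2l (mulr_ge0 c0 (W0 t)) (ltW kq)).
apply: le_trans le2 _.
rewrite [X in _ <= X](_ : _ = 2 * m * (t `^ (- e) * expR (lam * T))); last by ring.
rewrite ler_wpM2l ?mulr_ge0// ler_wpM2l ?powR_ge0// ler_expR ler_wpM2l//.
Qed.

(** * Existence of solutions by Picard iteration *)

(** The error bound is needed besides convergence: it makes the convergence of
    the Picard iterates uniform in the weighted norm. *)
Lemma geometric_cvg (R : realType) (V : completeNormedModType R)
    (x : nat -> V) (c : R) :
  (forall k, `|x k.+1 - x k| <= c * 2^-1 ^+ k) ->
  exists2 l, x k @[k --> \oo] --> l & forall k, `|l - x k| <= 2 * c * 2^-1 ^+ k.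
Proof.
move=> xc.
have c0 : 0 <= c by have := le_trans (normr_ge0 _) (xc 0%N); rewrite expr0 mulr1.
have p0 k : 0 <= (2^-1 : R) ^+ k by rewrite exprn_ge0.
have dist k j : `|x (k + j)%N - x k| <= 2 * c * 2^-1 ^+ k * (1 - 2^-1 ^+ j).
  elim: j => [|j IH]; first by rewrite addn0 subrr normr0 expr0 subrr mulr0.
  rewrite addnS -(subrK (x (k + j)%N) (x _.+1)) -addrA.
  apply: le_trans (ler_normD _ _) _.
  apply: le_trans (lerD (xc _) IH) _.
  by rewrite exprD exprS le_eqVlt; apply/orP; left; apply/eqP; field.
have dist' k m : (k <= m)%N -> `|x m - x k| <= 2 * c * 2^-1 ^+ k.
  move=> km; rewrite -(subnKC km); apply: le_trans (dist _ _) _.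
  by rewrite -[X in _ <= X]mulr1 ler_wpM2l ?mulr_ge0// gerBl.
have g0 : 2 * c * 2^-1 ^+ k @[k --> \oo] --> (0 : R).
  rewrite -[X in _ --> X](mulr0 (2 * c)); apply: cvgMr; apply: cvg_expr.
  by rewrite ger0_norm// invf_lt1// ltr1n.
have : cauchy (x k @[k --> \oo]).
  apply/cauchy_ballP => e e0.
  have e2 : 0 < e / 2 by rewrite divr_gt0.
  have [N _ HN] := cvgr_lt _ g0 _ e2.
  have xN m : (N <= m)%N -> `|x m - x N| < e / 2.
    by move=> Nm; apply: (le_lt_trans (dist' _ _ Nm)); apply: HN => /=.
  exists (x @` [set n | (N <= n)%N], x @` [set n | (N <= n)%N]).
    by split; exists N => // n Nn; exists n.
  move=> [_ _] [[n Nn <-] [m Nm <-]] /=; rewrite -ball_normE/=.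
  rewrite -(subrK (x N) (x n)) -addrA (splitr e).
  apply: le_lt_trans (ler_normD _ _) _; apply: ltrD; first exact: xN.
  by rewrite distrC; exact: xN.
move=> /cauchy_cvgP /cvg_ex[l xl]; exists l => // k.
apply/ler_addgt0Pr => e e0.
have /cvgrPdist_le/(_ _ e0)[N _ HN] := xl.
pose m := maxn N k.
rewrite -(subrK (x m) l) -addrA addrC; apply: le_trans (ler_normD _ _) _.
by apply: lerD; [apply: dist'; exact: leq_maxr|apply: HN; exact: leq_maxl].
Qed.

(** The Picard iteration u_(k+1) = h + sum of the integrals of u_k, started at 0.
    By the contraction estimate the increments decay like 2 ^ (- k) in the
    weighted norm of every (0, T]. The limit is thus continuous, has the same
    singularity at 0, and solves the equation. *)
Lemma volterra_exists (R : realType) (V : completeNormedModType R)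
    (d e : R) (n : nat) (A : 'I_n -> R -> V -> V) (h : R -> V) :
  0 <= d < 1 -> 0 <= e < 1 -> (forall i, singular_kernel d (A i)) ->
  continuous_pos h -> weighted_bound e h ->
  exists u, [/\ continuous_pos u, weighted_bound e u &
    forall t, 0 < t -> exists I : 'I_n -> V,
    (forall i, is_bochner_integral 0 t (fun x => A i (t - x) (u x)) (I i)) /\
    u t = h t + \sum_(i < n) I i].
Proof.
move=> d01 e01 kA ch bh; have /andP[e0 _] := e01.
pose good u := continuous_pos u /\ weighted_bound e (u : R -> V).
pose Phi u t : V := h t + \sum_(i < n) duhamel (A i) u t.
have bdu u t i : good u -> 0 < t ->
    bochner_ae 0 t (fun x => A i (t - x) (u x)) (duhamel (A i) u t).
  move=> [cu bu] t0; apply: is_bochner_integral_ae.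
  exact: (duhamel_integral d01 e01 (kA i) cu bu t0).
have contr T : 0 < T -> exists2 lam, 0 <= lam & forall u v b, good u -> good v ->
    0 <= b ->
    (forall t, 0 < t <= T -> `|u t - v t| <= b * (t `^ (- e) * expR (lam * t))) ->
    forall t, 0 < t <= T -> `|Phi u t - Phi v t| <= b / 2 * (t `^ (- e) * expR (lam
        * t)).
  move=> T0; have [lam lam0 Hlam] := kernel_contraction d01 e01 T0 kA.
  exists lam => // u v b gu gv b0 uv t tT; have /andP[t0 _] := tT.
  have -> : Phi u t - Phi v t =
      \sum_(i < n) ((-1) *: duhamel (A i) v t + duhamel (A i) u t).
    rewrite /Phi opprD addrACA subrr add0r -sumrB; apply: eq_bigr => i _.
    by rewrite scaleN1r addrC.
  apply: (Hlam (fun x => (-1) *: v x + u x) t b _ tT b0).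
    by move=> x xT; rewrite scaleN1r addrC uv.
  by move=> i; apply: bochner_ae_kernel_linear (kA i) (bdu v t i gv t0) (bdu u t i
      gu t0).
have W_ge (lam T t : R) : 0 <= lam -> 0 < t <= T ->
    t `^ (- e) <= t `^ (- e) * expR (lam * t) <= expR (lam * T) * t `^ (- e).
  move=> lam0 /andP[t0 tT]; rewrite ler_peMr ?powR_ge0//=; last first.
    by rewrite -expR0 ler_expR mulr_ge0// ltW.
  by rewrite mulrC ler_wpM2r ?powR_ge0// ler_expR ler_wpM2l.
have good0 : good (fun=> 0).
  split; first by move=> t _; exact: cvg_cst.
  by move=> T _; exists 0 => // t _; rewrite normr0 mul0r.
have goodB u v : good u -> good v -> weighted_bound e (fun t => u t - v t).
  move=> [_ bu] [_ bv]; have := weighted_bound_linear (-1) bv bu.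
  by under eq_fun do rewrite scaleN1r addrC.
have duhamel0 i t : 0 < t -> duhamel (A i) (fun=> 0) t = 0.
  move=> t0; rewrite /duhamel (_ : riemann_sum _ _ = fun=> 0) ?lim_cst//.
  apply/funext => m; rewrite /riemann_sum big1// => k _.
  have := kernel_linear (kA i) (t := t - node t m k.+1).
  rewrite subr_gt0 node_lt ?ltnS ?ltn_ord// => /(_ isT (-1) 0 0).
  by rewrite scaler0 addr0 scaleN1r addNr => ->; rewrite scaler0.
have goodPhi u : good u -> good (Phi u).
  move=> gu; have [cu bu] := gu; split.
    move=> t t0; apply: cvgD; first exact: ch.
    apply: (cvg_big add_continuous) => i _.
    exact: (duhamel_continuous d01 e01 (kA i) cu bu t0).
  move=> T T0; have [lam lam0 Hlam] := contr T T0.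
  have [a a0 Ha] := bu T T0; have [c c0 Hc] := bh T T0.
  exists (c + a / 2 * expR (lam * T)) => [|t tT].
    by rewrite addr_ge0// mulr_ge0 ?divr_ge0 ?expR_ge0.
  have /andP[W1 W2] := W_ge _ _ _ lam0 tT.
  have := Hlam u (fun=> 0) a gu good0 a0 _ t tT.
  (* Comparison with Phi 0 = h bounds Phi u. *)
  have -> : Phi (fun=> 0) t = h t.
    by rewrite /Phi big1 ?addr0// => i _; apply: duhamel0; case/andP: tT.
  move=> H; rewrite -(subrK (h t) (Phi u t)).
  apply: le_trans (ler_normD _ _) _; rewrite addrC mulrDl.
  apply: lerD; first exact: Hc.
  apply: le_trans (H _) _.
    move=> s sT; rewrite subr0; apply: le_trans (Ha _ sT) _.
    by rewrite ler_wpM2l//; have /andP[] := W_ge _ _ _ lam0 sT.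
  by rewrite -[X in _ <= X]mulrA ler_wpM2l// divr_ge0.
pose x k := iter k Phi (fun=> 0).
have gx k : good (x k) by elim: k => [|k IH] //; exact: goodPhi.
have step T : 0 < T -> exists lam c, [/\ 0 <= lam, 0 <= c & forall k t, 0 < t <= T ->
    `|x k.+1 t - x k t| <= c * (t `^ (- e) * expR (lam * t)) * 2^-1 ^+ k].
  move=> T0; have [lam lam0 Hlam] := contr T T0.
  have [c c0 Hc] := goodB _ _ (gx 1%N) (gx 0%N) T T0.
  exists lam, c; split => // k t tT; rewrite mulrAC.
  elim: k t tT => [|k IH] t tT.
    rewrite expr0 mulr1; apply: le_trans (Hc _ tT) _.
    by rewrite ler_wpM2l//; have /andP[] := W_ge _ _ _ lam0 tT.
  rewrite exprSr (mulrA c).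
  by apply: (Hlam (x k.+1) (x k) (c * 2^-1 ^+ k)) => //; rewrite mulr_ge0// exprn_ge0.
pose u t := lim (x k t @[k --> \oo]).
have ulim T : 0 < T -> exists lam c, [/\ 0 <= lam, 0 <= c & forall t, 0 < t <= T ->
    x k t @[k --> \oo] --> u t /\
    forall k, `|u t - x k t| <= 2 * (c * 2^-1 ^+ k) * (t `^ (- e) * expR (lam * t))].
  move=> T0; have [lam [c [lam0 c0 Hs]]] := step T T0; exists lam, c; split => // t tT.
  have [l xl Hl] := @geometric_cvg _ _ (fun k => x k t) _ (fun k => Hs k t tT).
  have -> : u t = l by apply/cvg_lim.
  split => // k; apply: le_trans (Hl k) _.
  by rewrite le_eqVlt; apply/orP; left; apply/eqP; ring.
have half0 (c : R) : c * 2^-1 ^+ k @[k --> \oo] --> (0 : R).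
  rewrite -[X in _ --> X](mulr0 c); apply: cvgMr; apply: cvg_expr.
  by rewrite ger0_norm// invf_lt1// ltr1n.
have bu : weighted_bound e u.
  move=> T T0; have [lam [c [lam0 c0 H]]] := ulim T T0.
  exists (2 * c * expR (lam * T)) => [|t tT]; first by rewrite !mulr_ge0 ?expR_ge0.
  have [_ /(_ 0%N)] := H t tT; rewrite subr0 expr0 mulr1 => /le_trans; apply.
  rewrite -[X in _ <= X]mulrA ler_wpM2l ?mulr_ge0//.
  by have /andP[] := W_ge _ _ _ lam0 tT.
have cu : continuous_pos u.
  move=> t t0; have t20 : 0 < t / 2 by rewrite divr_gt0.
  have t2 : t < 2 * t by rewrite mulr_natl mulr2n ltrDl.
  have [lam [c [lam0 c0 H]]] := ulim _ (lt_trans t0 t2).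
  apply/cvgrPdist_le => e' e'0.
  pose K := 2 * (expR (lam * (2 * t)) * (t / 2) `^ (- e)) * c.
  have e3 : 0 < e' / 3 by rewrite divr_gt0.
  have [k _ /(_ k (leqnn k)) /= Hk] := cvgr_lt _ (half0 K) _ e3.
  have ux s : t / 2 < s < 2 * t -> `|u s - x k s| <= e' / 3.
    move=> /andP[s1 s2]; have s0 := lt_trans t20 s1.
    have sT : 0 < s <= 2 * t by rewrite s0 ltW.
    have [_ /(_ k) Hs] := H s sT; apply: le_trans Hs _; apply: le_trans (ltW Hk).
    have /andP[_ W2] := W_ge _ _ _ lam0 sT.
    rewrite [X in _ <= X](_ : _ = 2 * (c * 2^-1 ^+ k) *
      (expR (lam * (2 * t)) * (t / 2) `^ (- e))); last by rewrite /K; ring.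
    rewrite ler_wpM2l ?mulr_ge0 ?exprn_ge0//; apply: le_trans W2 _.
    by rewrite ler_wpM2l ?expR_ge0// gt0_ler_powRN// ltW.
  have tt : t / 2 < t < 2 * t.
    by rewrite t2 andbT ltr_pdivrMr// mulr_natr mulr2n ltrDl.
  have [cx _] := gx k; have := cx t t0; move/cvgrPdist_le => /(_ _ e3) cxt.
  near=> s.
  have ts : t / 2 < s < 2 * t.
    apply/andP; split; near: s; last exact: lt_nbhsl.
    by apply: lt_nbhsr; case/andP: tt.
  have -> : u t - u s = (u t - x k t) + (x k t - x k s) + (x k s - u s).
    by rewrite !addrA subrK subrK.
  have -> : e' = e' / 3 + e' / 3 + e' / 3 by field.
  apply: le_trans (ler_normD _ _) _; apply: lerD; last first.
    by rewrite distrC; exact: ux.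
  apply: le_trans (ler_normD _ _) _; apply: lerD; first exact: ux.
  by near: s; exact: cxt.
exists u; split => // t t0.
exists (fun i => duhamel (A i) u t); split.
  by move=> i; exact: (duhamel_integral d01 e01 (kA i) cu bu t0).
rewrite -/(Phi u t).
have [lam1 lam10 Hlam] := contr t t0.
have [lam [c [lam0 c0 H]]] := ulim t t0.
have tt : 0 < t <= t by rewrite t0 lexx.
have [xu _] := H t tt.
(* The sequence x k.+1 = Phi (x k) tends to u and to Phi u. *)
have xS : x k.+1 t @[k --> \oo] --> u t.
  by move: xu; rewrite -(cvg_shiftS (fun k => x k t)).
have xP : x k.+1 t @[k --> \oo] --> Phi u t.
  apply/cvgrPdist_le => e' e'0.
  pose K := c * (expR (lam * t) * (t `^ (- e) * expR (lam1 * t))).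
  near=> k.
  have := Hlam u (x k) (2 * (c * 2^-1 ^+ k) * expR (lam * t)) (conj cu bu) (gx k).
  have b0 : 0 <= 2 * (c * 2^-1 ^+ k) * expR (lam * t).
    by rewrite !mulr_ge0 ?expR_ge0 ?exprn_ge0.
  move=> /(_ b0) Hk; apply: le_trans (Hk _ t tt) _.
    move=> s st; have [_ /(_ k) Hs] := H s st; apply: le_trans Hs _.
    rewrite -[X in _ <= X]mulrA ler_wpM2l ?mulr_ge0 ?exprn_ge0//.
    have /andP[_ W2] := W_ge _ _ _ lam0 st; apply: le_trans W2 _.
    by rewrite ler_wpM2l ?expR_ge0//; have /andP[] := W_ge _ _ _ lam10 st.
  rewrite [X in X <= _](_ : _ = K * 2^-1 ^+ k); last by rewrite /K; field.
  by near: k; exact: (cvgr_le _ (half0 K)).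
by rewrite -(cvg_lim _ xS)// -(cvg_lim _ xP).
Unshelve. all: by end_near. Qed.

(** * From kernels to the scale of spaces *)

Lemma strongly_measurable_continuous_pos (R : realType)
    (V : completeNormedModType R) (T : R) (u : R -> V) :
  continuous_pos u -> strongly_measurable `]0, T] u.
Proof.
(* T + 1, because the approximation is only claimed strictly before the end. *)
move=> cu; exists (step_approx (T + 1) u); first by move=> k; exact: simple_step_approx.
apply: aeW => t; rewrite /= in_itv/= => /andP[t0 tT].
apply: step_approx_cvg; last exact: cu.
by rewrite t0 (le_lt_trans tT)// ltrDl.
Qed.

Lemma weighted_Linfty_continuous_pos (R : realType)
    (V : completeNormedModType R) (e : R) (u : R -> V) :
  continuous_pos u -> weighted_bound e u -> weighted_Linfty e u.
Proof.
move=> cu bu T T0; split; last first.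
  have [c c0 Hc] := bu T T0; exists c => _ [t /= + <-].
  rewrite in_itv/= => tT; have /andP[t0 _] := tT.
  rewrite -[X in _ <= X]mul1r -(mulfV (lt0r_neq0 (powR_gt0 e t0))) -mulrA.
  by rewrite ler_wpM2l ?powR_ge0// -powRN mulrC Hc.
split; first exact: strongly_measurable_continuous_pos.
move=> K cK KT.
have cK' : {within K, continuous u}.
  apply: continuous_in_subspaceT => t /set_mem/KT.
  by rewrite /= in_itv/= => /andP[t0 _]; exact: cu.
have [M [_ HM]] := compact_bounded (continuous_compact cK' cK).
exists (M + 1); apply: aeW => t Kt; apply: (HM (M + 1)); last by exists t.
by rewrite ltrDl.
Qed.

Lemma weighted_bound_Linfty (R : realType) (V : completeNormedModType R)
    (e : R) (u : R -> V) : weighted_Linfty e u -> weighted_bound e u.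
Proof.
move=> Lu T T0; have [_ [c Hc]] := Lu T T0.
exists `|c| => // t tT; have /andP[t0 _] := tT.
have : t `^ e * `|u t| <= `|c|.
  by apply: le_trans (ler_norm c); apply: Hc; exists t => //=; rewrite in_itv.
by rewrite powRN ler_pdivlMr ?powR_gt0// mulrC.
Qed.

(** Raising the exponent lets finitely many kernels share one exponent. *)
Lemma singular_kernel_le (R : realType) (V : completeNormedModType R)
    (d d' : R) (A : R -> V -> V) : d' <= d ->
  singular_kernel d' A -> singular_kernel d A.
Proof.
move=> dd [lA cA bA]; split => // T T0; have [C C0 HC] := bA T T0.
exists (C * T `^ (d - d')); first by rewrite mulr_ge0 ?powR_ge0.
move=> t x tT; have /andP[t0 tT'] := tT; apply: le_trans (HC t x tT) _.
rewrite ler_wpM2r// -mulrA ler_wpM2l//.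
have -> : t `^ (- d') = t `^ (d - d') * t `^ (- d).
  by rewrite -powRD ?(gt_eqF t0) ?implybT//; congr (_ `^ _); ring.
by rewrite ler_wpM2r ?powR_ge0// ge0_ler_powR ?nnegrE ?subr_ge0 ?(ltW t0) ?(ltW T0).
Qed.

(** The difference of the two solutions solves the equation with zero forcing
    term, so that the a priori bound forces it to vanish. *)
Lemma volterra_unique (R : realType) (V : completeNormedModType R)
    (d e : R) (n : nat) (A : 'I_n -> R -> V -> V) (h k u v : R -> V) :
  0 <= d < 1 -> 0 <= e < 1 -> (forall i, singular_kernel d (A i)) ->
  volterra_solution A h u -> volterra_solution A k v ->
  weighted_bound e u -> weighted_bound e v ->
  (forall t, 0 < t -> h t = k t) -> forall t, 0 < t -> u t = v t.
Proof.
move=> d01 e01 kA su sv bu bv hk t t0.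
have [K K0 HK] := volterra_apriori d01 e01 t0 kA.
have tt : 0 < t <= t by rewrite t0 lexx.
have h0 s : 0 < s <= t -> `|(-1) *: k s + h s| <= 0 * s `^ (- e).
  by move=> /andP[s0 _]; rewrite hk// scaleN1r addNr normr0 mul0r.
have := HK _ _ 0 (lexx 0) (volterra_solution_linear (-1) kA sv su)
  (weighted_bound_linear (-1) bv bu) h0 t tt.
rewrite mulr0 mul0r normr_le0 scaleN1r addrC subr_eq0.
by move=> /eqP.
Qed.

Section Scale.
Context {R : realType} {J : Type} {X : banach_scale R J}.

Lemma in_spaceE (g : J) (x : banach_at X g) (a : ambient X) :
  emb X g x = a -> in_space g a = x.
Proof.
move=> xa; apply: (@emb_inj _ _ X g); rewrite xa.
exact: (@xgetPex _ 0 [set y | emb X g y = a] (ex_intro _ x xa)).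
Qed.

Lemma smooths_emb (F : op_family X) (g g' : J) (t : R) (u : banach_at X g) :
  smooths F g g' -> 0 < t -> emb X g' (in_space g' (F g t u)) = F g t u.
Proof.
move=> [_ [M [_ HM]]] t0; have [x xE _] := HM t t t0 t0 (lexx t) u.
by rewrite (in_spaceE xE).
Qed.

Lemma smooths_bound (F : op_family X) (g g' : J) (T : R) :
  smooths F g g' -> 0 < T -> exists2 C, 0 <= C & forall t u, 0 < t <= T ->
    `|in_space g' (F g t u)| <= C * t `^ (- reg_diff X g' g) * `|u|.
Proof.
move=> [_ [M [_ HM]]] T0; exists `|M T| => // t u /andP[t0 tT].
have [x xE xle] := HM T t T0 t0 tT u; rewrite (in_spaceE xE).
apply: le_trans xle _; rewrite ler_wpM2r// ler_wpM2r ?powR_ge0//.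
exact: ler_norm.
Qed.

Lemma smooths_linear (F : op_family X) (g g' : J) (t : R) :
  smooths F g g' -> 0 < t -> linear (F g t) ->
  linear (fun u => in_space g' (F g t u)).
Proof.
move=> sF t0 lF c u v; apply: in_spaceE.
by rewrite linearP !(smooths_emb _ sF t0) lF.
Qed.

Lemma continuously_smooths_continuous (F : op_family X) (g g' : J) u :
  continuously_smooths F g g' ->
  continuous_pos (fun t => in_space g' (F g t u)).
Proof.
move=> [_ /(_ u)]; rewrite continuous_open_subspace; last exact: interval_open.
by move=> cF t t0; apply: cF; rewrite inE/= in_itv/= t0.
Qed.

(** The best constant on (0, T], an infimum, is monotone in T because the bounds
    valid up to T2 are valid up to any smaller T1. *)
Lemma smooths_of_local_bounds (F : op_family X) (g g' : J) :
  0 <= reg_diff X g' g ->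
  (forall T, 0 < T -> exists2 M, 0 <= M & forall t u, 0 < t <= T ->
    exists2 x, emb X g' x = F g t u &
      `|x| <= M * t `^ (- reg_diff X g' g) * `|u|) ->
  smooths F g g'.
Proof.
move=> d0 loc; split => //.
pose B (T : R) := [set M : R | 0 <= M /\ forall t u, 0 < t <= T ->
    exists2 x, emb X g' x = F g t u &
      `|x| <= M * t `^ (- reg_diff X g' g) * `|u|].
have B0 T : 0 < T -> B T !=set0.
  by move=> /loc[M M0 HM]; exists M.
have Blb T : has_lbound (B T) by exists 0 => M [].
exists (fun T => inf (B T)); split.
  move=> T1 T2 T10 T12; apply: lb_le_inf.
    by apply: B0; apply: lt_le_trans T12.
  move=> M [M0 HM]; apply: ge_inf => //; split => // t u /andP[t0 tT].
  by apply: HM; rewrite t0 (le_trans tT).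
move=> T t T0 t0 tT u; have tT' : 0 < t <= T by rewrite t0.
have [M [M0 HM]] := B0 T T0; have [x xE xle] := HM t u tT'; exists x => //.
(* Divide by the weight, except when u = 0. *)
have [u0|u0] := eqVneq `|u| 0; first by move: xle; rewrite u0 !mulr0.
have w0 : 0 < t `^ (- reg_diff X g' g) * `|u|.
  by rewrite mulr_gt0 ?powR_gt0// lt0r u0/=.
rewrite -mulrA -ler_pdivrMr//; apply: lb_le_inf; first exact: B0.
move=> M' [_ HM']; have [y yE yle] := HM' t u tT'.
rewrite ler_pdivrMr// mulrA (_ : x = y)//.
by apply: (@emb_inj _ _ X g'); rewrite xE yE.
Qed.

Section PerturbedFamily.
Variables (S : op_family X) (hS : consistent_family S) (al : J) (n : nat).
Arguments S : clear implicits.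
Variables (be : 'I_n -> J) (rho : R) (rho_gt0 : 0 < rho).
Variable P : forall i : 'I_n, banach_at X al -> banach_at X (be i).
Hypothesis hP : forall i, perturbation_class S rho (P i).

Let A (i : 'I_n) (t : R) (x : banach_at X al) : banach_at X al :=
  in_space al (S (be i) t (P i x)).

(** The common exponent is the largest of the regularity gaps. *)
Lemma perturbation_kernel :
  exists2 d, 0 <= d < 1 & forall i, singular_kernel d (A i).
Proof.
pose d := \big[Num.max/0]_(i < n) reg_diff X al (be i).
exists d.
  rewrite bigmax_ge_id/=; apply: bigmax_lt => // i _.
  by have [/andP[]] := hP i.
move=> i; apply: (@singular_kernel_le _ _ _ (reg_diff X al (be i))).
  exact: (le_bigmax 0 (fun i => reg_diff X al (be i)) i).
have [linS _ _] := hS; have [dd csm lP bP] := hP i; have [sm _] := csm.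
split.
- move=> t t0 c x y; rewrite /A lP.
  exact: (smooths_linear sm t0 (linS _ _ (ltW t0))).
- by move=> x t t0; exact: (continuously_smooths_continuous csm t0).
move=> T T0; have [C C0 HC] := smooths_bound sm T0.
exists (C * rho); first by rewrite mulr_ge0// ltW.
move=> t x tT; apply: le_trans (HC t (P i x) tT) _.
rewrite [X in _ <= X](_ : _ = C * t `^ (- reg_diff X al (be i)) * (rho * `|x|));
    last by ring.
by rewrite ler_wpM2l ?mulr_ge0 ?powR_ge0.
Qed.

Variables (g : J) (hg : admissible S al g).

Let e01 : 0 <= reg_diff X al g < 1.
Proof. by have [/andP[g1 g2] _] := hg; rewrite /reg_diff subr_ge0 g2/= ltrBlDr
    -ltrBlDl. Qed.

Let h (u0 : banach_at X g) t := in_space al (S g t u0).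

Lemma solution_volterra (u0 : banach_at X g) (u : R -> banach_at X al) :
  solution S P u0 u ->
  volterra_solution A (h u0) u /\ weighted_bound (reg_diff X al g) u.
Proof.
move=> [Lu su]; split; last exact: weighted_bound_Linfty.
move=> t t0; have [I [bI uE]] := su t t0; exists I; split => // i.
exact: is_bochner_integral_ae (bI i).
Qed.

Lemma solution_exists (u0 : banach_at X g) :
  exists2 u, solution S P u0 u & continuous_pos u.
Proof.
have [d d01 kA] := perturbation_kernel.
have [_ csm] := hg; have [sm _] := csm.
have bh : weighted_bound (reg_diff X al g) (h u0).
  move=> T T0; have [C C0 HC] := smooths_bound sm T0.
  exists (C * `|u0|) => [|t tT]; first by rewrite mulr_ge0.
  by rewrite mulrAC; exact: HC.
have [u [cu bu su]] := volterra_exists d01 e01 kA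
  (continuously_smooths_continuous csm) bh.
exists u => //; split => //; exact: weighted_Linfty_continuous_pos.
Qed.

Lemma solution_unique (u0 : banach_at X g) (u v : R -> banach_at X al) :
  solution S P u0 u -> solution S P u0 v -> forall t, 0 < t -> v t = u t.
Proof.
have [d d01 kA] := perturbation_kernel.
move=> /solution_volterra[su bu] /solution_volterra[sv bv].
exact: (volterra_unique d01 e01 kA sv su bv bu).
Qed.

Lemma perturbed_familyE (u0 : banach_at X g) (u : R -> banach_at X al) t :
  solution S P u0 u -> 0 < t -> perturbed_family S P g t u0 = emb X al (u t).
Proof.
move=> su t0; rewrite /perturbed_family gt_eqF//; congr (emb X al _).
apply: (solution_unique su) t0.
exact: (@xgetPex _ (fun=> 0) [set u | solution S P u0 u] (ex_intro _ u su)).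
Qed.

(** Both sides solve the equation with the same forcing term. *)
Lemma perturbed_family_linear t : 0 <= t -> linear (perturbed_family S P g t).
Proof.
rewrite le_eqVlt => /predU1P[<-|t0] c x y.
  by rewrite /perturbed_family eqxx linearP.
have [d d01 kA] := perturbation_kernel.
have [u su _] := solution_exists x; have [v sv _] := solution_exists y.
have [w sw _] := solution_exists (c *: x + y).
rewrite (perturbed_familyE su t0) (perturbed_familyE sv t0) (perturbed_familyE sw t0).
rewrite -linearP; congr (emb X al _).
have [su' bu] := solution_volterra su; have [sv' bv] := solution_volterra sv.
have [sw' bw] := solution_volterra sw.
apply: (volterra_unique d01 e01 kA sw' (volterra_solution_linear c kA su' sv') bw
  (weighted_bound_linear c bu bv)) t0 => s s0.
have [linS _ _] := hS; have [_ [sm _]] := hg.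
exact: (smooths_linear sm s0 (linS _ _ (ltW s0))).
Qed.

(** The a priori bound with m = C * |u0| is linear in |u0|, which is the
    operator norm estimate; continuity in time comes from the solution built by
    iteration. *)
Lemma perturbed_family_smooths :
  continuously_smooths (perturbed_family S P) g al.
Proof.
have [d d01 kA] := perturbation_kernel.
have [_ [sm _]] := hg; split.
  apply: smooths_of_local_bounds; first by case/andP: e01.
  move=> T T0; have [K K0 HK] := volterra_apriori d01 e01 T0 kA.
  have [C C0 HC] := smooths_bound sm T0.
  exists (K * C) => [|t u0 tT]; first by rewrite mulr_ge0.
  have [u su _] := solution_exists u0; have /andP[t0 _] := tT.
  exists (u t); first by rewrite (perturbed_familyE su t0).
  have [su' bu] := solution_volterra su.
  have Cu : 0 <= C * `|u0| by rewrite mulr_ge0.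
  rewrite mulrAC -(mulrA K); apply: (HK _ _ _ Cu su' bu) tT => s sT.
  by rewrite mulrAC; exact: HC.
move=> u0; have [u su cu] := solution_exists u0.
rewrite continuous_open_subspace; last exact: interval_open.
move=> t; rewrite inE/= in_itv/= andbT => t0.
rewrite /continuous_at (in_spaceE (esym (perturbed_familyE su t0))).
apply: cvg_trans (cu t t0); apply: near_eq_cvg; near=> s.
apply/esym; apply: in_spaceE; apply/esym; apply: perturbed_familyE => //.
by near: s; exact: lt_nbhsr.
Unshelve. all: by end_near. Qed.

End PerturbedFamily.
End Scale.

Unset Implicit Arguments.
Theorem theorem6p5 (R : realType) (J : Type) (X : banach_scale R J)
    (S : op_family X) (hS : consistent_family S)
    (al : J) (n : nat) (be : 'I_n -> J) (rho : R) (rho_gt0 : 0 < rho)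
    (P : forall i : 'I_n, banach_at X al -> banach_at X (be i))
    (hP : forall i, perturbation_class S rho (P i)) :
  let S_P := perturbed_family S P in
  [/\ forall g : J, admissible S al g ->
        [/\ forall u0 : banach_at X g,
              exists u : R -> banach_at X al,
                [/\ solution S P u0 u,
                    forall v : R -> banach_at X al, solution S P u0 v ->
                      forall t : R, 0 < t -> v t = u t,
                    S_P g 0 u0 = emb X g u0
                  & forall t : R, 0 < t -> S_P g t u0 = emb X al (u t)],
            forall t : R, 0 <= t -> linear (S_P g t)
          & continuously_smooths S_P g al],
      forall i, admissible S al (be i) /\ continuously_smooths S_P (be i) al
    & continuously_smooths S al al ->
        admissible S al al /\ continuously_smooths S_P al al].
Proof.
move=> S_P.
have adm g : admissible S al g -> [/\ forall u0 : banach_at X g,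
      exists u : R -> banach_at X al,
        [/\ solution S P u0 u,
            forall v : R -> banach_at X al, solution S P u0 v ->
              forall t : R, 0 < t -> v t = u t,
            S_P g 0 u0 = emb X g u0
          & forall t : R, 0 < t -> S_P g t u0 = emb X al (u t)],
      forall t : R, 0 <= t -> linear (S_P g t)
    & continuously_smooths S_P g al].
  move=> hg; split.
  - move=> u0; have [u su _] := solution_exists hS rho_gt0 hP hg u0.
    exists u; split => //.
    + by move=> v sv; exact: (solution_unique hS rho_gt0 hP hg su sv).
    + by rewrite /S_P /perturbed_family eqxx.
    + by move=> t t0; exact: (perturbed_familyE hS rho_gt0 hP hg su t0).
  - by move=> t t0; exact: (perturbed_family_linear hS rho_gt0 hP hg t0).
  - exact: (perturbed_family_smooths hS rho_gt0 hP hg).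
split => //.
- move=> i; have [/andP[d0 d1] csm _ _] := hP i.
  have hbe : admissible S al (be i).
    split => //; rewrite -subr_ge0 d0 andbT ltrBlDr -ltrBlDl; exact: d1.
  by split => //; case: (adm _ hbe).
- move=> csm; have hal : admissible S al al.
    by split => //; rewrite lexx ltrBlDr ltrDl ltr01.
  by split => //; case: (adm _ hal).
Qed.
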